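(* Let $q$ be a prime power and $T$ a point of $\ell_\infty$ in $\mathrm{PG}(2,q^3)$. Two distinct tangent splashes of $\ell_\infty$ with common centre $T$ meet in at most an order-$q$-subline of $\ell_\infty$ containing $T$ (i.e. their intersection is contained in such a subline). Moreover, for any order-$q$-subline $m$ of $\ell_\infty$ containing $T$, there are exactly $q+1$ tangent splashes of $\ell_\infty$ with centre $T$ that contain $m$.
   Context: An order-$q$-subplane of $\mathrm{PG}(2,q^3)$ is a subplane of order $q$. An order-$q$-subline of a line is an image of $\mathrm{PG}(1,q)$ under $\mathrm{PGL}(2,q^3)$. If $\pi$ is an order-$q$-subplane meeting the line $\ell_\infty$ in exactly one point $T$, its tangent splash is the set of $q^2+1$ points of $\ell_\infty$ lying on the extension of some line of $\pi$; $T$ is its centre. A tangent splash with centre $T$ is any set arising this way. *)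

(* Defs.v *)
From HB Require Import structures.
From mathcomp Require Import all_boot all_order all_algebra.

Set Implicit Arguments.
Unset Strict Implicit.
Unset Printing Implicit Defensive.

Import GRing.Theory.
Local Open Scope ring_scope.

Module VspaceFinite.
Import VectorInternalTheory.
HB.instance Definition _ (K : finFieldType) (vT : vectType K) :=
  [Countable of {vspace vT} by <:].
HB.instance Definition _ (K : finFieldType) (vT : vectType K) :=
  [Finite of {vspace vT} by <:].
End VspaceFinite.
Export VspaceFinite.

(* [flat K n k] is the type of k-dimensional subspaces of K^n, so that
   PG(n - 1, K) has points [flat K n 1] and lines [flat K n 2]. *)
Definition flat (K : finFieldType) (n k : nat) : Type :=
  {U : {vspace 'rV[K]_n} | \dim U == k}.

HB.instance Definition _ (K : finFieldType) (n k : nat) :=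
  SubFinite.on (flat K n k).

Notation point K := (flat K 3 1).
Notation line K := (flat K 3 2).

Definition on_line (K : finFieldType) (P : point K) (l : line K) : bool :=
  (val P <= val l)%VS.

Definition prime_power (q : nat) : Prop :=
  exists p k : nat, [/\ prime p, (0 < k)%N & q = (p ^ k)%N].

Section Geometry.

Variables (K : finFieldType) (q : nat).

(* The points in B and the lines in L, with the incidence inherited from
   PG(2, K), form a projective plane of order q. A line of L is the full line
   of PG(2, K), i.e. the extension of a line of the subplane; the points of the
   subplane on it are those in B. *)
Definition subplane (B : {set point K}) (L : {set line K}) : bool :=
  [&& [forall P in B, forall Q in B, (P != Q) ==>
         (#|[set l in L | on_line P l && on_line Q l]| == 1%N)],
      [forall l in L, forall m in L, (l != m) ==>
         (#|[set P in B | on_line P l && on_line P m]| == 1%N)],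
      [exists X : {set point K}, [&& X \subset B, #|X| == 4%N &
         [forall l in L, (#|[set P in X | on_line P l]| <= 2)%N]]]
    & [forall l in L, #|[set P in B | on_line P l]| == q.+1]].

Definition splash (linf : line K) (L : {set line K}) : {set point K} :=
  [set P | on_line P linf && [exists l in L, on_line P l]].

Definition tangent_splash (linf : line K) (T : point K)
    (S : {set point K}) : bool :=
  [exists B : {set point K}, exists L : {set line K},
    [&& subplane B L, [set P in B | on_line P linf] == [set T]
      & S == splash linf L]].

(* PG(1, q) inside PG(1, K): the points with a coordinate vector over the
   subfield of order q. When #|K| is a power of q, as in all uses below, this
   subfield is the set of solutions of x ^ q = x. *)
Definition canonical_subline : {set flat K 2 1} :=
  [set P | [exists v : 'rV[K]_2,
    [&& v != 0, [forall i, v 0 i ^+ q == v 0 i] & val P == <[v]>%VS]]].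

(* A linear bijection f from K^2 onto the 2-dimensional space l is a choice of
   homogeneous coordinates on the line l; any two differ by an element of
   GL(2, K), so letting f vary amounts to taking all the images of PG(1, q)
   under PGL(2, K). *)
Definition subline (l : line K) (m : {set point K}) : Prop :=
  exists2 f : 'Hom('rV[K]_2, 'rV[K]_3), limg f = val l &
    m = [set P | [exists Q in canonical_subline, val P == (f @: val Q)%VS]].

End Geometry.

(* Main.v *)
Require Import Defs.
From mathcomp Require Import all_boot all_order all_algebra.
From mathcomp Require Import all_field zify ring.

(* Take homogeneous coordinates in which T = <(1, 0, 0)> and linf is the line
   z = 0, let F be the subfield of order q, and write the points of linf other
   than T as <(u, 1, 0)> with u in K. Then
   - the sublines through T are the sets {T} + (b + F a) with a <> 0;
   - the tangent splashes with centre T are the sets {T} + (b + F a1 + F a2)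
     with a1, a2 independent over F.
   So the theorem is about lines and planes of the affine space K over F: two
   distinct planes meet inside a line, and a line of AG(3, q) lies on q + 1
   planes.

   That a tangent splash is an affine F-plane does not use that the subplane is
   a projective image of PG(2, q). Its lines off T are x = u y + v z with (u, v)
   in a set A of q^2 pairs, its points other than T are <(x, y, 1)>, and y takes
   q + 1 values, each with a set X_y of q values of x. If k1 y1 + k2 y2 = y with
   k1 + k2 = 1, then k1 X_y1 + k2 X_y2 is contained in X_y, and all three sets
   have q elements; so, up to translation, X_y1 is an additive group and X_y2 a
   multiple of it. Varying y gives q elements of K that stabilise this group,
   hence all of F, and the group is F h. *)

Set Implicit Arguments.
Unset Strict Implicit.
Unset Printing Implicit Defensive.

Import GRing.Theory.
Local Open Scope ring_scope.

(** * The subfield F of order q *)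

Definition subfield_of_order (K : finFieldType) (q : nat) : {set K} :=
  [set x | x ^+ q == x].

Section Splash.

Variables (K : finFieldType) (q : nat).
Hypothesis hq : prime_power q.
Hypothesis hK : #|K| = (q ^ 3)%N.

Local Notation F := (subfield_of_order K q).

Lemma prime_power_gt1 : (1 < q)%N.
Proof.
case: hq => p [k [pp k0 ->]].
by rewrite -(exp1n k) ltn_exp2r // prime_gt1.
Qed.

(** Since q is a power of the characteristic of K, the map x -> x^q is additive; closure of F under
    sums and opposites rests on this. *)
Lemma pchar_nat_order : (GRing.pchar K).-nat q.
Proof.
have [p [k [pp k0 qE]]] := hq.
have pK : p \in GRing.pchar K.
  by apply: (@card_finPcharP _ _ (k * 3)%N); rewrite ?hK ?qE -?expnM.
by rewrite qE (eq_pnat _ (pcharf_eq pK)) pnatX pnat_id.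
Qed.

Lemma subf0 : 0 \in F.
Proof. by rewrite inE expr0n; case: q prime_power_gt1. Qed.

Lemma subf1 : 1 \in F.
Proof. by rewrite inE expr1n. Qed.

Lemma subfD x y : x \in F -> y \in F -> x + y \in F.
Proof.
by rewrite !inE => /eqP hx /eqP hy; rewrite (exprDn_pchar _ _ pchar_nat_order) hx hy.
Qed.

Lemma subfN x : x \in F -> - x \in F.
Proof. by rewrite !inE => /eqP hx; rewrite (exprNn_pchar _ pchar_nat_order) hx. Qed.

Lemma subfB x y : x \in F -> y \in F -> x - y \in F.
Proof. by move=> hx hy; rewrite subfD ?subfN. Qed.

Lemma subfM x y : x \in F -> y \in F -> x * y \in F.
Proof. by rewrite !inE => /eqP hx /eqP hy; rewrite exprMn hx hy. Qed.

Lemma subfV x : x \in F -> x^-1 \in F.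
Proof. by rewrite !inE => /eqP hx; rewrite exprVn hx. Qed.

(** X^q - X divides X^(q^3) - X, the product of X - x over all x in K, so it splits into q distinct
    linear factors. *)
Lemma card_subfield : #|F| = q.
Proof.
have q1 := prime_power_gt1.
have q0 : (0 < q)%N by apply: ltnW.
pose p : {poly K} := 'X^q - 'X.
have sp : size p = q.+1.
  by rewrite /p size_polyDl ?size_polyXn // size_polyN size_polyX ltnS.
have pd : p %| \prod_x ('X - x%:P).
  rewrite -finField_genPoly hK.
  (* In this form the exponents q - 1 and q^3 - 1 show that X^(q-1) - 1 divides X^(q^3-1) - 1. *)
  have -> : (q ^ 3)%N = (q.-1 * (q ^ 2 + q + 1)).+1.
    by case: (q) q0 => // n _; rewrite /=; ring.
  have XB n : 'X^(n.+1) - 'X = 'X * ('X^n - 1) :> {poly K} by rewrite mulrBr mulr1 exprS.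
  rewrite /p -{1}(prednK q0) !XB dvdp_mul // exprM [X in _ %| X]subrX1.
  exact: dvdp_mulr.
have [m pm] := dvdp_prod_XsubC pd.
set s := mask m _ in pm.
have us : uniq s by rewrite mask_uniq // /index_enum -enumT enum_uniq.
have ss : size s = q.
  by have := eqp_size pm; rewrite sp size_prod_XsubC => -[].
suff -> : F = [set x in s] by rewrite cardsE (card_uniqP us).
apply/setP=> x; rewrite !inE -subr_eq0.
rewrite -(root_prod_XsubC s) -(eqp_root pm) /p /root !hornerE.
by [].
Qed.

(** Multiplication by a nonzero x in [X] permutes the q - 1 nonzero elements of [X]; comparing their
    products before and after gives x^(q-1) = 1. *)
Lemma closed_subset_subfield (X : {set K}) : #|X| = q -> 0 \in X -> 1 \in X ->
  {in X &, forall x y, x * y \in X} -> X \subset F.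
Proof.
move=> cX X0 X1 XM; apply/subsetP => x xX; rewrite inE.
have [->|x0] := eqVneq x 0; first by have := subf0; rewrite inE.
have q0 : (0 < q)%N by apply: ltnW prime_power_gt1.
rewrite -(prednK q0) exprS; suff -> : x ^+ q.-1 = 1 by rewrite mulr1.
have inj : injective (fun y => x * y) by apply: mulfI.
have im : [set x * y | y in X :\ 0] = X :\ 0.
  apply/eqP; rewrite eqEcard card_imset // leqnn andbT.
  apply/subsetP => _ /imsetP[y /setD1P[y0 yX] ->].
  by rewrite !inE mulf_neq0 ?XM.
have P0 : \prod_(y in X :\ 0) y != 0.
  by apply/prodf_neq0 => y /setD1P[].
apply: (mulIf P0); rewrite mul1r -[in RHS]im.
rewrite big_imset /=; last by move=> ? ? _ _; apply: inj.
rewrite big_split prodr_const /=; congr (_ ^+ _ * _).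
by have := cardsD1 0 X; rewrite X0 cX => ->.
Qed.



(** * Affine F-planes in K, and the slopes of the lines of a subplane *)

Definition indep (a b : K) : Prop :=
  {in F &, forall l m, l * a + m * b = 0 -> l = 0 /\ m = 0}.

Definition affine_plane (b a1 a2 : K) : {set K} :=
  [set b + lm.1 * a1 + lm.2 * a2 | lm in setX F F].

Lemma affine_planeP (b a1 a2 u : K) :
  reflect (exists l m, [/\ l \in F, m \in F & u = b + l * a1 + m * a2])
          (u \in affine_plane b a1 a2).
Proof.
apply: (iffP imsetP) => [[[l m]]|[l [m [hl hm ->]]]].
  by rewrite in_setX => /andP[/= hl hm] ->; exists l, m.
by exists (l, m); rewrite ?in_setX ?hl ?hm.
Qed.

Lemma mem_inj_eq_card (T U : finType) (f : T -> U) (S : {set T}) (S' : {set U}) :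
  injective f -> #|S| = #|S'| -> {in S, forall x, f x \in S'} ->
  forall x, (f x \in S') = (x \in S).
Proof.
move=> inj e fS x.
have <- : f @: S = S'.
  apply/eqP; rewrite eqEcard card_imset // e leqnn andbT.
  by apply/subsetP => _ /imsetP[z zS ->]; apply: fS.
exact: mem_imset.
Qed.

Section AffineStructure.

(** A pair [(u, v)] in [A] stands for the line x = u y + v z off T, and [(x, y)] in [B] for the
    point <(x, y, 1)>. Then [Y] indexes the lines of the subplane through T, and [X y] lists the
    points other than T on one of them. *)
Variables A B : {set K * K}.
Let X y := [set x | (x, y) \in B].
Let Y := [set y | X y != set0].
Hypothesis A_fst_inj : forall u v v', (u, v) \in A -> (u, v') \in A -> v = v'.
Hypothesis AY : forall u v y, (u, v) \in A -> y \in Y -> (u * y + v, y) \in B.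
Hypothesis join : forall x y x' y', (x, y) \in B -> (x', y') \in B -> y != y' ->
  exists u v, [/\ (u, v) \in A, x = u * y + v & x' = u * y' + v].
Hypothesis cX : forall y, y \in Y -> #|X y| = q.
Hypothesis cY : #|Y| = q.+1.

Lemma affine_structure : exists b a1 a2, indep a1 a2 /\
  [set u | [exists v, (u, v) \in A]] = affine_plane b a1 a2.
Proof.
have q1 := prime_power_gt1.
have /card_gt2P[y1 [y2 [y3 [[Y1 Y2 Y3] [n12 n23 n31]]]]] : (2 < #|Y|)%N by rewrite cY.
have d12 : y1 - y2 != 0 by rewrite subr_eq0.
have /set0Pn[o1] : X y1 != set0 by move: Y1; rewrite inE.
have /set0Pn[o2] : X y2 != set0 by move: Y2; rewrite inE.
move=> O2 O1.
(* Barycentric coordinates of y with respect to y1 and y2: [k1 y + k2 y = 1] and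
   [k1 y * y1 + k2 y * y2 = y]. A line x = u y + v through two points therefore passes through their
   combination with these weights. *)
pose k1 y := (y - y2) / (y1 - y2); pose k2 y := (y1 - y) / (y1 - y2).
have comb y x1 x2 : y \in Y -> x1 \in X y1 -> x2 \in X y2 ->
    k1 y * x1 + k2 y * x2 \in X y.
  rewrite ![_ \in X _]inE => yY h1 h2.
  have [u [v [uvA -> ->]]] := join h1 h2 n12.
  suff -> : k1 y * (u * y1 + v) + k2 y * (u * y2 + v) = u * y + v.
    exact: (AY uvA yY).
  by rewrite /k1 /k2; field.
(* The fibre over y translated by [- o]; the origins o1, o2 lie in the fibres over y1, y2, so that
   both translates contain 0. *)
pose Z o y := [set z | z + o \in X y].
have cZ o y : y \in Y -> #|Z o y| = q.
  move=> yY; rewrite -(cX yY) -(card_preimset (X y) (addIr o)).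
  by apply: eq_card => z; rewrite !inE.
pose o y := k1 y * o1 + k2 y * o2.
have combZ y z1 z2 : y \in Y -> z1 \in Z o1 y1 -> z2 \in Z o2 y2 ->
    k1 y * z1 + k2 y * z2 \in Z (o y) y.
  rewrite ![_ \in Z _ _]inE => yY h1 h2.
  have -> : k1 y * z1 + k2 y * z2 + o y = k1 y * (z1 + o1) + k2 y * (z2 + o2).
    by rewrite /o; ring.
  exact: comb.
have Z10 : 0 \in Z o1 y1 by rewrite inE add0r.
have Z20 : 0 \in Z o2 y2 by rewrite inE add0r.
have k1n y : y != y2 -> k1 y != 0 by move=> h; rewrite mulf_neq0 ?invr_eq0 ?subr_eq0.
have k2n y : y1 != y -> k2 y != 0 by move=> h; rewrite mulf_neq0 ?invr_eq0 ?subr_eq0.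
(* With the other argument fixed at 0, the combination embeds one fibre in another of the same size
   q, hence is onto. *)
have E1 y z : y \in Y -> y != y2 -> (k1 y * z \in Z (o y) y) = (z \in Z o1 y1).
  move=> yY yn; apply: mem_inj_eq_card; first exact/mulfI/k1n.
    by rewrite !cZ.
  by move=> x xZ; have := combZ y x 0 yY xZ Z20; rewrite mulr0 addr0.
have E2 y z : y \in Y -> y1 != y -> (k2 y * z \in Z (o y) y) = (z \in Z o2 y2).
  move=> yY yn; apply: mem_inj_eq_card; first exact/mulfI/k2n.
    by rewrite !cZ.
  by move=> x xZ; have := combZ y 0 x yY Z10 xZ; rewrite mulr0 add0r.
(* For every y in [Y] other than y1 and y2, multiplication by [r y] carries the first fibre onto the
   second. *)
pose r y := k1 y / k2 y.
have Er y z : y \in Y -> y != y2 -> y1 != y -> (r y * z \in Z o2 y2) = (z \in Z o1 y1).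
  move=> yY yn yn'; rewrite -(E2 y) // -(E1 y) //.
  by rewrite mulrA [_ * r y]mulrC divfK ?k2n.
have n32 : y3 != y2 by rewrite eq_sym.
have n13 : y1 != y3 by rewrite eq_sym.
have ZD : {in Z o1 y1 &, forall z z', z + z' \in Z o1 y1}.
  move=> z z' hz hz'; rewrite -(E1 y3) //.
  have := combZ y3 z (r y3 * z') Y3 hz; rewrite Er // => /(_ hz').
  by rewrite mulrA [_ * r y3]mulrC divfK ?k2n // -mulrDr.
(* The multipliers preserving the first fibre. Any two [r y] carry it onto the same set, so their
   ratios belong to [S]. *)
pose S := [set c | [forall z in Z o1 y1, c * z \in Z o1 y1]].
have SP c : reflect {in Z o1 y1, forall z, c * z \in Z o1 y1} (c \in S).
  by rewrite inE; apply: (iffP forall_inP).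
have r3n : r y3 != 0 by rewrite mulf_neq0 ?invr_eq0 ?k1n ?k2n.
have rS y : y \in Y -> y != y2 -> y1 != y -> r y / r y3 \in S.
  move=> yY yn yn'; apply/SP => z hz; rewrite -(Er y3) //.
  by rewrite mulrA [_ * (_ / _)]mulrCA divff // mulr1 Er.
have S0 : 0 \in S by apply/SP => z _; rewrite mul0r.
have S1 : 1 \in S by apply/SP => z; rewrite mul1r.
have SM : {in S &, forall c d, c * d \in S}.
  by move=> c d /SP hc /SP hd; apply/SP => z hz; rewrite -mulrA; apply/hc/hd.
have leS : (q <= #|S|)%N.
  (* Removing y1 and y2 from the q + 1 elements of [Y] leaves q - 1 values of y. The fractional
     linear map [r] is injective and nonzero on them, so these ratios together with 0 are q elements
     of [S]. *)
  pose R := [set r y / r y3 | y in Y :\ y1 :\ y2].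
  have cR : #|R| = q.-1.
    rewrite card_in_imset.
      have := cardsD1 y2 (Y :\ y1); have := cardsD1 y1 Y.
      by rewrite in_setD1 [y2 == y1]eq_sym n12 Y1 Y2 cY !add1n => -[->] ->.
    move=> y y'; rewrite !in_setD1 => /and3P[a1 a2 _] /and3P[b1 b2 _].
    move/(mulIf (invr_neq0 r3n)) => e; apply/eqP; rewrite -subr_eq0.
    have a3 : y1 - y != 0 by rewrite subr_eq0 eq_sym.
    have b3 : y1 - y' != 0 by rewrite subr_eq0 eq_sym.
    have /eqP : (r y - r y') * (y1 - y) * (y1 - y') = 0 by rewrite e subrr !mul0r.
    have -> : (r y - r y') * (y1 - y) * (y1 - y') = (y - y') * (y1 - y2).
      by rewrite /r /k1 /k2; field; rewrite d12 a3 b3.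
    by rewrite mulf_eq0 (negbTE d12) orbF.
  have <- : #|0 |: R| = q.
    rewrite cardsU1 cR; case: imsetP => [[y]|_]; last by rewrite add1n prednK // ltnW.
    rewrite !in_setD1 => /and3P[a1 a2 _] /esym/eqP.
    rewrite mulf_eq0 invr_eq0 (negbTE r3n) orbF mulf_eq0 invr_eq0.
    by rewrite (negbTE (k1n _ a1)) (negbTE (k2n _ _)) // eq_sym.
  apply: subset_leq_card; apply/subsetP => x /setU1P[->//|/imsetP[y]].
  by rewrite !in_setD1 => /and3P[a1 a2 yY] ->; apply: rS; rewrite // eq_sym.
have [h hZ h0] : exists2 h, h \in Z o1 y1 & h != 0.
  have : (0 < #|Z o1 y1 :\ 0%R|)%N.
    by have := cardsD1 0 (Z o1 y1); rewrite Z10 cZ // add1n => e; rewrite -ltnS -e.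
  by case/card_gt0P => h /setD1P[]; exists h.
(* The map c -> c h embeds [S], of size at least q, in a fibre of size q: the fibre is [S] h and [S]
   has exactly q elements, whence [S] is F. *)
have im : [set c * h | c in S] = Z o1 y1.
  apply/eqP; rewrite eqEcard card_imset; last exact: mulIf.
  rewrite cZ // leS andbT; apply/subsetP => _ /imsetP[c /SP hc ->]; exact: hc.
have cS : #|S| = q by rewrite -(cZ o1 y1) // -im card_imset //; apply: mulIf.
have SF : S = F.
  apply/eqP; rewrite eqEcard cS card_subfield leqnn andbT.
  exact: closed_subset_subfield.
have Z1E z : reflect (exists2 c, c \in F & z = c * h) (z \in Z o1 y1).
  by rewrite -im SF; apply: (iffP imsetP).
pose g := r y3 * h.
have g0 : g != 0 by rewrite mulf_neq0.
have Z2E z : reflect (exists2 c, c \in F & z = c * g) (z \in Z o2 y2).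
  have -> : (z \in Z o2 y2) = (z / r y3 \in Z o1 y1).
    by rewrite -(Er y3) // mulrCA divff // mulr1.
  apply: (iffP (Z1E _)) => -[c cF e]; exists c => //.
    by rewrite /g mulrCA -e mulrCA divff // mulr1.
  by rewrite e /g; field.
(* The slope of the line joining (o1 + l h, y1) to (o2 + m g, y2): the difference of the x's divided
   by y1 - y2. *)
pose U l m := (o1 - o2) / (y1 - y2) + l * (h / (y1 - y2)) + m * (- g / (y1 - y2)).
have inA l m : l \in F -> m \in F -> exists v,
    [/\ (U l m, v) \in A, o1 + l * h = U l m * y1 + v & o2 + m * g = U l m * y2 + v].
  move=> hl hm.
  have l1 : (l * h + o1, y1) \in B.
    have /Z1E : exists2 c, c \in F & l * h = c * h by exists l.
    by rewrite !inE.
  have l2 : (m * g + o2, y2) \in B.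
    have /Z2E : exists2 c, c \in F & m * g = c * g by exists m.
    by rewrite !inE.
  have [u [v [uvA e1 e2]]] := join l1 l2 n12.
  exists v; suff <- : u = U l m by rewrite ![_ + _ * _]addrC.
  have -> : u = ((l * h + o1) - (m * g + o2)) / (y1 - y2) by rewrite e1 e2; field.
  by rewrite /U; field.
exists ((o1 - o2) / (y1 - y2)), (h / (y1 - y2)), (- g / (y1 - y2)); split.
  (* A relation between the two directions gives the line for (l, m) the slope of the line for (0,
     0). Lines in [A] of equal slope are equal, so their points over y1 and y2 agree, which forces l
     h = m g = 0. *)
  move=> l m hl hm e.
  have [v [vA e1 e2]] := inA _ _ hl hm.
  have [v' [vA' e1' e2']] := inA _ _ subf0 subf0.
  have UE : U l m = U 0 0 by rewrite /U -!addrA e !mul0r !addr0.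
  rewrite {}UE in vA e1 e2; have vE := A_fst_inj vA vA'.
  move: e1 e2; rewrite vE -e1' -e2' !mul0r => /addrI/eqP.
  rewrite mulf_eq0 (negbTE h0) orbF => /eqP -> /addrI/eqP.
  by rewrite mulf_eq0 (negbTE g0) orbF => /eqP.
apply/setP => u; rewrite inE; apply/existsP/affine_planeP.
  case=> v uvA.
  have /Z1E[l lF e1] : u * y1 + v - o1 \in Z o1 y1 by have := AY uvA Y1; rewrite !inE subrK.
  have /Z2E[m mF e2] : u * y2 + v - o2 \in Z o2 y2 by have := AY uvA Y2; rewrite !inE subrK.
  exists l, m; split => //; rewrite mulrA -e1 mulrA mulrN -e2.
  by field.
by case=> l [m [lF mF ->]]; have [v [vA _ _]] := inA _ _ lF mF; exists v.
Qed.

End AffineStructure.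

(** * Lines and planes of the affine space K over F *)

Definition multiples (a : K) : {set K} := [set l * a | l in F].

Definition affine_line (b a : K) : {set K} := [set b + x | x in multiples a].

Lemma multiplesP a x : reflect (exists2 l, l \in F & x = l * a) (x \in multiples a).
Proof. exact: imsetP. Qed.

Lemma affine_lineP b a u :
  reflect (exists2 l, l \in F & u = b + l * a) (u \in affine_line b a).
Proof.
apply: (iffP imsetP) => [[x /multiplesP[l lF ->] ->]|[l lF ->]]; first by exists l.
by exists (l * a) => //; apply/multiplesP; exists l.
Qed.

Lemma indep_neq0 a1 a2 : indep a1 a2 -> a1 != 0.
Proof.
move=> ind; apply/eqP => a0; have [/eqP] : (1 : K) = 0 /\ (0 : K) = 0.
  by apply: ind; rewrite ?subf0 ?subf1 // a0 mulr0 mul0r addr0.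
by rewrite oner_eq0.
Qed.

Lemma indep_notin_multiples a c : a != 0 -> c \notin multiples a -> indep a c.
Proof.
move=> a0 ca l m lF mF e; have m0 : m = 0.
  apply/eqP; apply: contraR ca => m0; apply/multiplesP; exists (- l / m).
    by rewrite subfM ?subfN ?subfV.
  apply: (mulfI m0); move/eqP: e; rewrite addrC addr_eq0 => /eqP ->.
  by field.
split=> //; move/eqP: e; rewrite m0 mul0r addr0 mulf_eq0 (negbTE a0) orbF.
by move/eqP.
Qed.

Lemma card_multiples a : a != 0 -> #|multiples a| = q.
Proof. by move=> a0; rewrite card_imset ?card_subfield //; apply: mulIf. Qed.

Lemma card_affine_plane b a1 a2 : indep a1 a2 -> #|affine_plane b a1 a2| = (q ^ 2)%N.
Proof.
move=> ind; rewrite card_in_imset; first by rewrite cardsX card_subfield mulnn.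
move=> [l m] [l' m']; rewrite !in_setX => /andP[/= lF mF] /andP[/= lF' mF'] e.
have [] := ind (l - l') (m - m') (subfB lF lF') (subfB mF mF').
  by transitivity ((b + l * a1 + m * a2) - (b + l' * a1 + m' * a2)); [ring | rewrite e subrr].
by move/eqP; rewrite subr_eq0 => /eqP -> /eqP; rewrite subr_eq0 => /eqP ->.
Qed.

Lemma affine_plane_origin b a1 a2 : b \in affine_plane b a1 a2.
Proof. by apply/affine_planeP; exists 0, 0; rewrite subf0 !mul0r !addr0. Qed.

(** The differences [c1], [c2] of points of the plane are F-combinations of [a1], [a2], so the plane
    on the right is contained in the one on the left; both have q^2 elements. *)
Lemma affine_plane_rebase b a1 a2 p c1 c2 : indep a1 a2 -> indep c1 c2 ->
  p \in affine_plane b a1 a2 -> p + c1 \in affine_plane b a1 a2 ->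
  p + c2 \in affine_plane b a1 a2 -> affine_plane b a1 a2 = affine_plane p c1 c2.
Proof.
move=> ia ic /affine_planeP[l0 [m0 [l0F m0F pE]]] /affine_planeP[l1 [m1 [l1F m1F e1]]].
move=> /affine_planeP[l2 [m2 [l2F m2F e2]]].
apply/esym/eqP; rewrite eqEcard !card_affine_plane // leqnn andbT.
apply/subsetP => _ /affine_planeP[i [j [iF jF ->]]].
apply/affine_planeP; exists (l0 + i * (l1 - l0) + j * (l2 - l0)).
exists (m0 + i * (m1 - m0) + j * (m2 - m0)); split.
- by rewrite !subfD ?subfM ?subfB.
- by rewrite !subfD ?subfM ?subfB.
have -> : c1 = p + c1 - p by ring.
have -> : c2 = p + c2 - p by ring.
by rewrite e1 e2 pE; ring.
Qed.

(** If the intersection held three non-collinear points, rebasing both planes at these points would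
    identify them. *)
Lemma affine_plane_meet b a1 a2 b' a1' a2' : indep a1 a2 -> indep a1' a2' ->
  affine_plane b a1 a2 != affine_plane b' a1' a2' ->
  exists p c, c != 0 /\
    affine_plane b a1 a2 :&: affine_plane b' a1' a2' \subset affine_line p c.
Proof.
move=> ia ia' ne; set U := affine_plane b a1 a2; set U' := affine_plane b' a1' a2'.
(* An intersection with at most one point imposes no direction, and 1 serves as the direction of the
   line. *)
have [->|[p pU]] := set_0Vmem (U :&: U').
  by exists 0, 1; rewrite oner_neq0 sub0set.
have [UI|/subsetPn[r rU]] := boolP (U :&: U' \subset [set p]).
  exists p, 1; rewrite oner_neq0; split=> //; apply: subset_trans UI _.
  by rewrite sub1set; apply/affine_lineP; exists 0; rewrite ?subf0 ?mul0r ?addr0.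
rewrite inE -subr_eq0 => d0; exists p, (r - p); split=> //.
apply/subsetP => s sU; apply/affine_lineP.
have [/multiplesP[l lF e]|sd] := boolP (s - p \in multiples (r - p)).
  by exists l; rewrite // -e addrC subrK.
case/eqP: ne; have ic := indep_notin_multiples d0 sd.
move: pU rU sU; rewrite !inE => /andP[pU pU'] /andP[rU rU'] /andP[sU sU'].
have pK x : p + (x - p) = x by rewrite addrC subrK.
rewrite (@affine_plane_rebase b a1 a2 p (r - p) (s - p)) ?pK //.
by rewrite (@affine_plane_rebase b' a1' a2' p (r - p) (s - p)) ?pK.
Qed.

Lemma affine_line_sub_plane b a c : affine_line b a \subset affine_plane b a c.
Proof.
apply/subsetP => _ /affine_lineP[l lF ->]; apply/affine_planeP.
by exists l, 0; rewrite subf0 mul0r addr0.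
Qed.

(** The second direction c can be [a1], or [a2] when [a1] is a multiple of [a]; the plane is then
    rebased at b. *)
Lemma plane_through_line b a b' a1 a2 : a != 0 -> indep a1 a2 ->
  affine_line b a \subset affine_plane b' a1 a2 ->
  exists2 c, c \notin multiples a & affine_plane b' a1 a2 = affine_plane b a c.
Proof.
move=> a0 ind /subsetP sub.
have bU : b \in affine_plane b' a1 a2.
  by apply/sub/affine_lineP; exists 0; rewrite ?subf0 ?mul0r ?addr0.
have baU : b + a \in affine_plane b' a1 a2.
  by apply/sub/affine_lineP; exists 1; rewrite ?subf1 ?mul1r.
have dir : b + a1 \in affine_plane b' a1 a2 /\ b + a2 \in affine_plane b' a1 a2.
  have /affine_planeP[l [m [lF mF ->]]] := bU; split; apply/affine_planeP.
    by exists (l + 1), m; split=> //; [apply: subfD subf1 | ring].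
  by exists l, (m + 1); split=> //; [apply: subfD subf1 | ring].
have [c ca cU] : exists2 c, c \notin multiples a & b + c \in affine_plane b' a1 a2.
  have [/multiplesP[l lF e]|] := boolP (a1 \in multiples a); last by exists a1; case: dir.
  exists a2; last by case: dir.
  apply/negP => /multiplesP[m mF e'].
  have [_ /eqP] : m = 0 /\ - l = 0.
    by apply: ind; rewrite ?subfN // e e'; ring.
  by rewrite oppr_eq0 => /eqP l0; have := indep_neq0 ind; rewrite e l0 mul0r eqxx.
by exists c => //; apply: affine_plane_rebase => //; apply: indep_notin_multiples.
Qed.

(** Count the q^3 - q elements c outside F a by the plane they span with the line: each plane arises
    from q^2 - q of them, and q^3 - q = (q + 1)(q^2 - q). *)
Lemma card_planes_through_line b a : a != 0 ->
  #|[set affine_plane b a c | c in ~: multiples a]| = q.+1.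
Proof.
move=> a0; have q1 := prime_power_gt1.
pose f c := affine_plane b a c.
have cD : #|~: multiples a| = (q ^ 3 - q)%N.
  by have := cardsC (multiples a); rewrite card_multiples // hK => <-; rewrite addKn.
have fib c0 : c0 \in ~: multiples a ->
    #|[set c in ~: multiples a | f c == f c0]| = (q ^ 2 - q)%N.
  rewrite in_setC => c0a; have ind0 := indep_notin_multiples a0 c0a.
  (* By rebasing, c gives the plane of c0 exactly when b + c lies in that plane. *)
  have -> : [set c in ~: multiples a | f c == f c0] =
      [set c | b + c \in f c0] :\: multiples a.
    apply/setP => c; rewrite !inE; have [ca|ca] //= := boolP (c \in multiples a).
    have ind := indep_notin_multiples a0 ca.
    apply/eqP/idP => [<-|bc].
      by apply/affine_planeP; exists 0, 1; rewrite subf0 subf1 mul0r addr0 mul1r.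
    apply/esym/affine_plane_rebase => //; first exact: affine_plane_origin.
    by apply/affine_planeP; exists 1, 0; rewrite subf0 subf1 mul0r addr0 mul1r.
  have -> : [set c | b + c \in f c0] = +%R b @^-1: f c0 by apply/setP => c; rewrite !inE.
  have sub : multiples a \subset +%R b @^-1: f c0.
    apply/subsetP => c ca; rewrite inE; apply: (subsetP (affine_line_sub_plane b a c0)).
    by apply/imsetP; exists c.
  by rewrite cardsD (setIidPr sub) card_preimset ?card_affine_plane ?card_multiples //; apply: addrI.
have : (q ^ 3 - q = #|f @: (~: multiples a)| * (q ^ 2 - q))%N.
  rewrite -cD -sum1_card (partition_big_imset f) /= -sum_nat_const.
  apply: eq_bigr => _ /imsetP[c0 c0D ->]; rewrite -(fib c0 c0D) -sum1_card.
  by apply: eq_bigl => c; rewrite inE.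
have -> : (q ^ 3 - q = q.+1 * (q ^ 2 - q))%N.
  by rewrite mulnBr !expnS expn0 !mulSn !muln1; lia.
move/eqP; rewrite eqn_pmul2r; first by move/eqP.
by rewrite subn_gt0 -{1}(expn1 q) ltn_exp2l.
Qed.

(** * Coordinate vectors of length 3, with dot and cross products *)

Definition vec (x y z : K) : 'rV[K]_3 := \row_(i < 3) [:: x; y; z]`_i.

Lemma vecP (v : 'rV[K]_3) : exists x y z, v = vec x y z.
Proof.
exists (v 0 0), (v 0 1), (v 0 2%:R); apply/rowP => i; rewrite mxE.
by case: i => -[|[|[|//]]] hi /=; congr (v 0 _); apply: val_inj.
Qed.

Lemma vec_eq0 x y z : (vec x y z == 0) = [&& x == 0, y == 0 & z == 0].
Proof.
apply/eqP/and3P => [/rowP e|[/eqP-> /eqP-> /eqP->]].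
  by have := (e 0, e 1, e 2%:R); rewrite !mxE /= => -[[-> ->] ->].
by apply/rowP => i; rewrite !mxE; case: i => -[|[|[|//]]].
Qed.

Lemma vec_inj x y z x' y' z' : vec x y z = vec x' y' z' -> [/\ x = x', y = y' & z = z'].
Proof. by move/rowP => e; have := (e 0, e 1, e 2%:R); rewrite !mxE /= => -[[-> ->] ->]. Qed.

Lemma scale_vec c x y z : c *: vec x y z = vec (c * x) (c * y) (c * z).
Proof. by apply/rowP => i; rewrite !mxE; case: i => -[|[|[|//]]]. Qed.

Lemma add_vec x y z x' y' z' : vec x y z + vec x' y' z' = vec (x + x') (y + y') (z + z').
Proof. by apply/rowP => i; rewrite !mxE; case: i => -[|[|[|//]]]. Qed.

Definition dot (v w : 'rV[K]_3) : K := (v *m w^T) 0 0.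

Lemma dot_vec x y z x' y' z' :
  dot (vec x y z) (vec x' y' z') = x * x' + y * y' + z * z'.
Proof. by rewrite /dot mxE !big_ord_recl big_ord0 !mxE /= addr0 addrA. Qed.

Lemma dotC v w : dot v w = dot w v.
Proof. by rewrite /dot -[w *m _]trmxK [RHS]mxE trmx_mul trmxK. Qed.

Lemma dot_mull (N : 'M[K]_3) v w : dot (v *m N) w = dot v (w *m N^T).
Proof. by rewrite /dot trmx_mul trmxK mulmxA. Qed.

Lemma dotDl v v' w : dot (v + v') w = dot v w + dot v' w.
Proof. by rewrite /dot mulmxDl mxE. Qed.

Lemma dotZl c v w : dot (c *: v) w = c * dot v w.
Proof. by rewrite /dot -scalemxAl mxE. Qed.

Definition cross (v w : 'rV[K]_3) : 'rV[K]_3 :=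
  vec (v 0 1 * w 0 2%:R - v 0 2%:R * w 0 1)
      (v 0 2%:R * w 0 0 - v 0 0 * w 0 2%:R)
      (v 0 0 * w 0 1 - v 0 1 * w 0 0).

Lemma cross_vec x y z x' y' z' : cross (vec x y z) (vec x' y' z') =
  vec (y * z' - z * y') (z * x' - x * z') (x * y' - y * x').
Proof. by rewrite /cross !mxE. Qed.

Lemma dot_crossl v w : dot v (cross v w) = 0.
Proof.
have [x [y [z ->]]] := vecP v; have [x' [y' [z' ->]]] := vecP w.
by rewrite cross_vec dot_vec; ring.
Qed.

Lemma dot_crossr v w : dot w (cross v w) = 0.
Proof.
have [x [y [z ->]]] := vecP v; have [x' [y' [z' ->]]] := vecP w.
by rewrite cross_vec dot_vec; ring.
Qed.

Lemma cross_eq0 v w : v != 0 -> cross v w = 0 -> exists c, w = c *: v.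
Proof.
have [x [y [z ->]]] := vecP v; have [x' [y' [z' ->]]] := vecP w.
rewrite cross_vec => v0 /eqP; rewrite vec_eq0 !subr_eq0 => /and3P[/eqP e1 /eqP e2 /eqP e3].
have [x0|x0] := eqVneq x 0; last first.
  exists (x' / x); rewrite scale_vec; congr vec; apply: (mulfI x0).
  - by field.
  - by rewrite e3; field.
  - by rewrite -e2; field.
have [y0|y0] := eqVneq y 0; last first.
  exists (y' / y); rewrite scale_vec; congr vec; apply: (mulfI y0).
  - by rewrite -e3; field.
  - by field.
  - by rewrite e1; field.
have z0 : z != 0 by move: v0; rewrite vec_eq0 x0 y0 eqxx.
exists (z' / z); rewrite scale_vec; congr vec; apply: (mulfI z0).
- by rewrite e2; field.
- by rewrite -e1; field.
- by field.
Qed.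

(** By the triple product identity, (v x w) x X = (v . X) w - (w . X) v, which vanishes here; so X
    is proportional to v x w. *)
Lemma cross_perp v w x : cross v w != 0 -> dot v x = 0 -> dot w x = 0 ->
  exists c, x = c *: cross v w.
Proof.
move=> n0 hv hw; apply: (cross_eq0 n0); move: hv hw {n0}.
have [a [b [c ->]]] := vecP v; have [a' [b' [c' ->]]] := vecP w.
have [r [s [t ->]]] := vecP x; rewrite !cross_vec !dot_vec => e e'.
apply/eqP; rewrite vec_eq0; apply/and3P; split; apply/eqP.
- by transitivity (a' * (a * r + b * s + c * t) - a * (a' * r + b' * s + c' * t));
    [ring | rewrite e e'; ring].
- by transitivity (b' * (a * r + b * s + c * t) - b * (a' * r + b' * s + c' * t));
    [ring | rewrite e e'; ring].
- by transitivity (c' * (a * r + b * s + c * t) - c * (a' * r + b' * s + c' * t));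
    [ring | rewrite e e'; ring].
Qed.

(** * Homogeneous coordinates for the points and lines of PG(2, K) *)

Lemma line_unique (U V : {vspace 'rV[K]_3}) (p r : 'rV[K]_3) :
  \dim U = 2%N -> \dim V = 2%N -> p != 0 -> r \notin <[p]>%VS ->
  p \in U -> r \in U -> p \in V -> r \in V -> U = V.
Proof.
move=> dU dV p0 rp pU rU pV rV.
have d2 : (2 <= \dim (U :&: V))%N.
  rewrite ltnNge; apply: contra rp => d1.
  suff /eqP -> : <[p]>%VS == (U :&: V)%VS by rewrite memv_cap rU rV.
  by rewrite eqEdim -memvE memv_cap pU pV dim_vline p0.
have /eqP <- : (U :&: V)%VS == U by rewrite eqEdim capvSl dU.
by apply/eqP; rewrite eqEdim capvSr dV.
Qed.

(** The line with dual coordinates [w] in the frame given by the rows of [M]. A vector x has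
    coordinates [x *m invmx M], so the equation of the line makes it the kernel of a linear form. *)
Definition perp (M : 'M[K]_3) (w : 'rV[K]_3) : {vspace 'rV[K]_3} :=
  lker (linfun (mulmxr (invmx M *m w^T))).

Lemma mem_perp M w v : M \in unitmx -> (v *m M \in perp M w) = (dot v w == 0).
Proof.
move=> hM; rewrite memv_ker lfunE /= mulmxA mulmxK // /dot.
apply/eqP/eqP => [->|e]; first by rewrite mxE.
by apply/rowP => i; rewrite !ord1 e mxE.
Qed.

Lemma dot_nondeg w : w != 0 -> exists v, dot v w != 0.
Proof.
have [x [y [z ->]]] := vecP w; rewrite vec_eq0 !negb_and => /or3P[] h.
- by exists (vec 1 0 0); rewrite dot_vec mul1r !mul0r !addr0.
- by exists (vec 0 1 0); rewrite dot_vec mul1r !mul0r addr0 add0r.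
- by exists (vec 0 0 1); rewrite dot_vec mul1r !mul0r !add0r.
Qed.

Lemma dim_perp M w : M \in unitmx -> w != 0 -> \dim (perp M w) == 2%N.
Proof.
move=> hM w0.
have [v hv] := dot_nondeg w0.
rewrite /perp; set f := linfun _.
have := limg_ker_dim f fullv; rewrite capfv dimvf.
have -> : \dim (f @: fullv) = 1%N.
  apply/eqP; rewrite eqn_leq; apply/andP; split.
    by apply: leq_trans (dimvS (subvf _)) _; rewrite dimvf.
  rewrite lt0n dimv_eq0; apply: contra hv => /eqP e.
  by rewrite -(mem_perp _ _ hM) memv_ker -memv0 -e memv_img // memvf.
by rewrite /dim /= mul1n addn1 => -[->].
Qed.

Fact dim_point0 : \dim <[(vec 1 0 0)%R]>%VS == 1%N.
Proof. by rewrite dim_vline vec_eq0 oner_eq0. Qed.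

Fact dim_line0 : \dim ((perp 1%:M (vec 0 0 1))%R) == 2%N.
Proof. by rewrite dim_perp ?unitmx1 // vec_eq0 oner_eq0 !andbF. Qed.

Definition point0 : point K := exist (fun U : {vspace _} => \dim U == 1%N) _ dim_point0.
Definition line0 : line K := exist (fun U : {vspace _} => \dim U == 2%N) _ dim_line0.

Section Coordinates.

Variable M : 'M[K]_3.
Hypothesis hM : M \in unitmx.

(* Homogeneous coordinates with respect to the rows of M; the values at the
   zero vector are junk. *)
Definition pt (v : 'rV[K]_3) : point K := insubd point0 <[v *m M]>%VS.
Definition ln (w : 'rV[K]_3) : line K := insubd line0 (perp M w).

Lemma mulM_eq0 (v : 'rV[K]_3) : (v *m M == 0) = (v == 0).
Proof. by apply/eqP/eqP => [e|->]; rewrite ?mul0mx // -(mulmxK hM v) e mul0mx. Qed.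

Lemma val_pt v : v != 0 -> val (pt v) = <[v *m M]>%VS.
Proof. by move=> v0; rewrite val_insubd dim_vline mulM_eq0 v0. Qed.

Lemma val_ln w : w != 0 -> val (ln w) = perp M w.
Proof. by move=> w0; rewrite val_insubd dim_perp. Qed.

Lemma on_pt_ln v w : v != 0 -> w != 0 -> on_line (pt v) (ln w) = (dot v w == 0).
Proof. by move=> v0 w0; rewrite /on_line val_pt // val_ln // -memvE mem_perp. Qed.

Lemma pt_surj (P : point K) : exists2 v, v != 0 & P = pt v.
Proof.
have dP := eqP (valP P).
have e0 : vpick (val P) != 0 by rewrite vpick0 -dimv_eq0 dP.
have v0 : vpick (val P) *m invmx M != 0 by rewrite -mulM_eq0 mulmxKV.
exists (vpick (val P) *m invmx M) => //; apply: val_inj; rewrite val_pt // mulmxKV //.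
by apply/eqP; rewrite eq_sym eqEdim -memvE memv_pick dP dim_vline e0.
Qed.

Lemma eq_pt v w : v != 0 -> w != 0 -> reflect (exists c, w = c *: v) (pt w == pt v).
Proof.
move=> v0 w0; rewrite -val_eqE /= !val_pt // eqEdim !dim_vline !mulM_eq0 v0 w0 andbT -memvE.
apply: (iffP (vlineP _ _)) => -[c e]; exists c; last by rewrite e -scalemxAl.
by rewrite -(mulmxK hM w) e -scalemxAl mulmxK.
Qed.

Lemma pt_scale c v : c != 0 -> v != 0 -> pt (c *: v) = pt v.
Proof. by move=> c0 v0; apply/eqP/eq_pt; rewrite ?scaler_eq0 ?negb_or ?c0 //; exists c. Qed.

Lemma cross_neq0 v w : v != 0 -> w != 0 -> pt w != pt v -> cross v w != 0.
Proof. by move=> v0 w0; apply: contra => /eqP /(cross_eq0 v0) /(eq_pt v0 w0). Qed.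

(** The dual coordinates of a line are the cross product of the coordinates of two independent
    vectors on it. *)
Lemma ln_surj (l : line K) : exists2 w, w != 0 & l = ln w.
Proof.
have dl := eqP (valP l).
have p0 : vpick (val l) != 0 by rewrite vpick0 -dimv_eq0 dl.
set p := vpick (val l) in p0.
have /subvPn[r rl rp] : ~~ (val l <= <[p]>)%VS.
  by apply/negP => /dimvS; rewrite dl dim_vline p0.
have pE : p *m invmx M *m M = p by rewrite mulmxKV.
have rE : r *m invmx M *m M = r by rewrite mulmxKV.
have v0 : p *m invmx M != 0 by rewrite -mulM_eq0 pE.
have w0 : cross (p *m invmx M) (r *m invmx M) != 0.
  apply: contra rp => /eqP /(cross_eq0 v0) [c e].
  by apply/vlineP; exists c; rewrite -rE e -scalemxAl pE.
exists (cross (p *m invmx M) (r *m invmx M)) => //; apply: val_inj; rewrite val_ln //.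
apply: (line_unique dl (eqP (dim_perp hM w0)) p0 rp (memv_pick _) rl).
  by rewrite -pE mem_perp // pE dot_crossl.
by rewrite -rE mem_perp // rE dot_crossr.
Qed.

Lemma eq_ln v w : v != 0 -> w != 0 -> reflect (exists c, w = c *: v) (ln w == ln v).
Proof.
move=> v0 w0; apply: (iffP eqP) => [e|[c e]].
  apply: (cross_eq0 v0); apply/eqP/contraT => n0.
  have [x hx] := dot_nondeg n0.
  have e' y : y != 0 -> dot y v = 0 -> dot y w = 0.
    by move=> y0 /eqP; rewrite -on_pt_ln // -e on_pt_ln // => /eqP.
  (* The vector v x X is on the line of v, hence on that of w; but its product with w is, up to
     sign, that of X with v x w, which was chosen nonzero. *)
  have : dot (cross v x) w = 0.
    have [->|y0] := eqVneq (cross v x) 0; first by rewrite /dot mul0mx mxE.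
    by apply: e'; rewrite // dotC dot_crossl.
  move/eqP; apply/contraTT => _; move: hx.
  have [a [b [c ->]]] := vecP v; have [a' [b' [c' ->]]] := vecP w.
  have [r [s [t ->]]] := vecP x; rewrite !cross_vec !dot_vec.
  by apply: contra => /eqP h; apply/eqP; rewrite -[RHS]oppr0 -h; ring.
have c0 : c != 0 by apply: contraNneq w0 => c0; rewrite e c0 scale0r.
apply: val_inj; rewrite !val_ln //; apply/vspaceP => x.
rewrite -(mulmxKV hM x) !mem_perp // e.
by rewrite dotC dotZl mulf_eq0 (negbTE c0) dotC.
Qed.

Lemma ln_scale c v : c != 0 -> v != 0 -> ln (c *: v) = ln v.
Proof. by move=> c0 v0; apply/eqP/eq_ln; rewrite ?scaler_eq0 ?negb_or ?c0 //; exists c. Qed.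

End Coordinates.

(** * F-rational vectors and the subplane they form in a given frame *)

Definition rational (v : 'rV[K]_3) : bool := [forall i, v 0 i \in F].

Lemma rational_vec x y z : rational (vec x y z) = [&& x \in F, y \in F & z \in F].
Proof.
apply/forallP/and3P => [h|[hx hy hz] i].
  by have := (h 0, h 1, h 2%:R); rewrite !mxE /= => -[[-> ->] ->].
by rewrite mxE; case: i => -[|[|[|//]]].
Qed.

Lemma rational_comb c v w : c \in F -> rational v -> rational w -> rational (v + c *: w).
Proof.
by move=> cF /forallP hv /forallP hw; apply/forallP => i; rewrite !mxE subfD ?subfM.
Qed.

Lemma rational_cross v w : rational v -> rational w -> rational (cross v w).
Proof.
by move=> /forallP hv /forallP hw; rewrite rational_vec !subfB ?subfM.
Qed.

(** Taking the cross product of the relation with [w] leaves only [i *: cross v w]; with [v] it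
    leaves only [j *: cross v w]. *)
Lemma cross_free v w i j : cross v w != 0 -> i *: v + j *: w = 0 -> i = 0 /\ j = 0.
Proof.
move=> n0 e.
have crossZ c : c *: cross v w = 0 -> c = 0.
  by move/eqP; rewrite scaler_eq0 (negbTE n0) orbF => /eqP.
split; apply: crossZ.
  transitivity (cross (i *: v + j *: w) w); last first.
    by rewrite e /cross !mxE !mul0r !subr0; apply/eqP; rewrite vec_eq0 eqxx.
  have [a [b [c ->]]] := vecP v; have [a' [b' [c' ->]]] := vecP w.
  by rewrite [cross (vec a b c) _]cross_vec !scale_vec add_vec cross_vec; congr vec; ring.
transitivity (cross v (i *: v + j *: w)); last first.
  by rewrite e /cross !mxE !mulr0 !subr0; apply/eqP; rewrite vec_eq0 eqxx.
have [a [b [c ->]]] := vecP v; have [a' [b' [c' ->]]] := vecP w.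
by rewrite [cross (vec a b c) _]cross_vec !scale_vec add_vec cross_vec; congr vec; ring.
Qed.

(** The equation is solved over F for the coordinate at the first nonzero entry of [w]; the other
    two coordinates are free and serve as i and j. *)
Lemma rational_perp_basis w : w != 0 -> rational w -> exists v v',
  [/\ rational v /\ rational v', cross v v' != 0, dot v w = 0 /\ dot v' w = 0
    & forall z, rational z -> dot z w = 0 ->
        exists i j, [/\ i \in F, j \in F & z = i *: v + j *: v']].
Proof.
have [x [y [z ->]]] := vecP w; rewrite rational_vec => w0 /and3P[hx hy hz].
have F0 := subf0; have F1 := subf1.
have [x0|x0] := eqVneq x 0; last first.
  exists (vec (- (y / x)) 1 0), (vec (- (z / x)) 0 1).
  split.
  - by rewrite !rational_vec F0 F1 !subfN ?subfM ?subfV.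
  - by rewrite cross_vec vec_eq0 !mulr1 !mulr0 !subr0 oner_eq0.
  - by rewrite !dot_vec; split; field.
  - move=> v; have [a [b [c ->]]] := vecP v.
    rewrite rational_vec dot_vec => /and3P[ha hb hc] e.
    exists b, c; split=> //; rewrite !scale_vec add_vec; congr vec; try ring.
    by apply: (mulIf x0); apply/eqP; rewrite -subr_eq0 -[X in _ == X]e; apply/eqP; field.
have [y0|y0] := eqVneq y 0; last first.
  exists (vec 1 0 0), (vec 0 (- (z / y)) 1).
  split.
  - by rewrite !rational_vec F0 F1 !subfN ?subfM ?subfV.
  - by rewrite cross_vec vec_eq0 !mul0r !mulr1 !sub0r !oppr_eq0 oner_eq0 !andbF.
  - by rewrite !dot_vec x0; split; field.
  - move=> v; have [a [b [c ->]]] := vecP v.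
    rewrite rational_vec dot_vec => /and3P[ha hb hc] e.
    move: e; rewrite x0 mulr0 add0r => e.
    exists a, c; split=> //; rewrite !scale_vec add_vec; congr vec; try ring.
    by apply: (mulIf y0); apply/eqP; rewrite -subr_eq0 -[X in _ == X]e; apply/eqP; field.
have z0 : z != 0 by move: w0; rewrite vec_eq0 x0 y0 eqxx.
exists (vec 1 0 0), (vec 0 1 0).
split.
- by rewrite !rational_vec F0 F1.
- by rewrite cross_vec vec_eq0 !mulr1 !mul0r !subr0 oner_eq0 !andbF.
- by rewrite !dot_vec x0 y0; split; ring.
- move=> v; have [a [b [c ->]]] := vecP v; rewrite rational_vec dot_vec => /and3P[ha hb hc].
  rewrite x0 y0 !mulr0 !add0r => /eqP; rewrite mulf_eq0 (negbTE z0) orbF => /eqP ->.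
  by exists a, b; split=> //; rewrite !scale_vec add_vec; congr vec; ring.
Qed.

Lemma uniq4 (U : eqType) (a b c d : U) :
  a != b -> a != c -> a != d -> b != c -> b != d -> c != d -> uniq [:: a; b; c; d].
Proof. by rewrite /= !inE !negb_or => -> -> -> -> -> ->. Qed.

Lemma card_set_seq (U : finType) (s : seq U) : uniq s -> #|[set x in s]| = size s.
Proof. by move=> us; rewrite cardsE (card_uniqP us). Qed.

Lemma card_sift_seq (U : finType) (s : seq U) (p : pred U) :
  (#|[set x in [set x in s] | p x]| <= count p s)%N.
Proof.
rewrite -size_filter; apply: leq_trans (card_size _); apply: subset_leq_card.
by apply/subsetP => x; rewrite !inE mem_filter andbC.
Qed.

Section RationalSubplane.

Variable M : 'M[K]_3.
Hypothesis hM : M \in unitmx.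

Definition rational_points : {set point K} :=
  [set pt M v | v : 'rV[K]_3 & (v != 0) && rational v].
Definition rational_lines : {set line K} :=
  [set ln M w | w : 'rV[K]_3 & (w != 0) && rational w].

Lemma rational_pointsP P :
  reflect (exists v, [/\ v != 0, rational v & P = pt M v]) (P \in rational_points).
Proof.
apply: (iffP imsetP) => [[v]|[v [v0 rv ->]]].
  by rewrite inE => /andP[v0 rv] ->; exists v.
by exists v; rewrite ?inE ?v0.
Qed.

Lemma rational_linesP l :
  reflect (exists w, [/\ w != 0, rational w & l = ln M w]) (l \in rational_lines).
Proof.
apply: (iffP imsetP) => [[v]|[v [v0 rv ->]]].
  by rewrite inE => /andP[v0 rv] ->; exists v.
by exists v; rewrite ?inE ?v0.
Qed.

(** With an F-basis v, v' of the rational solutions, the points are <v> and the <v' + l v> for l in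
    F: 1 + q of them. *)
Lemma card_rational_line l : l \in rational_lines ->
  #|[set P in rational_points | on_line P l]| = q.+1.
Proof.
case/rational_linesP => w [w0 rw ->] {l}.
have [v [v' [[rv rv'] n0 [dv dv'] gen]]] := rational_perp_basis w0 rw.
have free := cross_free n0.
have v0 : v != 0.
  apply/eqP => e; have [/eqP] : (1 : K) = 0 /\ (0 : K) = 0.
    by apply: free; rewrite e scaler0 scale0r addr0.
  by rewrite oner_eq0.
have u0 l : v' + l *: v != 0.
  apply/eqP => e; have [_ /eqP] : l = 0 /\ (1 : K) = 0.
    by apply: free; rewrite scale1r addrC.
  by rewrite oner_eq0.
have relation l c i : v' + l *: v = c *: v' + i *: v -> l = i /\ 1 = c.
  move=> e; have [/eqP + /eqP] : l - i = 0 /\ 1 - c = 0.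
    apply: free; rewrite !scalerBl scale1r addrACA -opprD [l *: v + _]addrC e.
    by rewrite [i *: v + _]addrC subrr.
  by rewrite !subr_eq0 => /eqP -> /eqP.
have -> : [set P in rational_points | on_line P (ln M w)] =
    pt M v |: [set pt M (v' + l *: v) | l in F].
  apply/setP => P; rewrite inE; apply/andP/setU1P.
    case=> /rational_pointsP[z [z0 rz ->]]; rewrite on_pt_ln // => /eqP dz.
    have [i [j [iF jF zE]]] := gen z rz dz.
    have [j0|j0] := eqVneq j 0; [left|right].
      by apply/eqP/eq_pt => //; exists i; rewrite zE j0 scale0r addr0.
    apply/imsetP; exists (j^-1 * i); first by rewrite subfM ?subfV.
    apply/eqP/eq_pt => //; exists j.
    by rewrite scalerDr scalerA mulrA divff // mul1r addrC.
  case=> [->|/imsetP[l lF ->]].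
    by rewrite on_pt_ln // dv eqxx; split=> //; apply/rational_pointsP; exists v.
  rewrite on_pt_ln // dotDl dotZl dv dv' mulr0 addr0 eqxx; split=> //.
  by apply/rational_pointsP; exists (v' + l *: v); rewrite u0 rational_comb.
rewrite cardsU1 card_in_imset ?card_subfield.
  case: imsetP => // -[l _ /esym/eqP/(eq_pt hM v0 (u0 l))[c e]].
  have [_ /eqP] : l = c /\ 1 = 0 :> K by apply: relation; rewrite e scale0r add0r.
  by rewrite oner_eq0.
move=> l l' lF lF' /eqP/(eq_pt hM (u0 l') (u0 l))[c e].
have [-> <-] : l = c * l' /\ 1 = c by apply: relation; rewrite e scalerDr scalerA.
by rewrite mul1r.
Qed.

Lemma rational_subplane : subplane q rational_points rational_lines.
Proof.
apply/and4P; split.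
- apply/forall_inP => _ /rational_pointsP[v [v0 rv ->]].
  apply/forall_inP => _ /rational_pointsP[v' [v0' rv' ->]]; apply/implyP => ne.
  have n0 : cross v v' != 0 by apply: (cross_neq0 hM v0 v0'); rewrite eq_sym.
  apply/cards1P; exists (ln M (cross v v')); apply/setP => l; rewrite !inE.
  apply/and3P/eqP => [[/rational_linesP[w [w0 rw ->]]]|->].
    rewrite !on_pt_ln // => /eqP dv /eqP dv'.
    by apply/eqP/eq_ln => //; apply: cross_perp.
  rewrite !on_pt_ln // dot_crossl dot_crossr eqxx; split=> //.
  by apply/rational_linesP; exists (cross v v'); rewrite rational_cross.
- apply/forall_inP => _ /rational_linesP[v [v0 rv ->]].
  apply/forall_inP => _ /rational_linesP[v' [v0' rv' ->]]; apply/implyP => ne.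
  have n0 : cross v v' != 0.
    by apply: contra ne => /eqP /(cross_eq0 v0) /(eq_ln hM v0 v0'); rewrite eq_sym.
  apply/cards1P; exists (pt M (cross v v')); apply/setP => l; rewrite !inE.
  apply/and3P/eqP => [[/rational_pointsP[w [w0 rw ->]]]|->].
    rewrite !on_pt_ln // ![dot w _]dotC => /eqP dv /eqP dv'.
    by apply/eqP/eq_pt => //; apply: cross_perp.
  rewrite !on_pt_ln // ![dot (cross _ _) _]dotC dot_crossl dot_crossr eqxx; split=> //.
  by apply/rational_pointsP; exists (cross v v'); rewrite rational_cross.
(* The quadrangle consists of the coordinate triangle and the unit point. *)
- pose s : seq 'rV[K]_3 := [:: vec 1 0 0; vec 0 1 0; vec 0 0 1; vec 1 1 1].
  have s0 v : v \in s -> v != 0.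
    by rewrite !inE => /or4P[] /eqP ->; rewrite vec_eq0 oner_eq0 ?andbF.
  have us : uniq [seq pt M v | v <- s].
    have ne v w : v != 0 -> w != 0 -> cross v w != 0 -> pt M v != pt M w.
      move=> v0 w0 n0; apply/negP => /(eq_pt hM w0 v0)[c e].
      have [/eqP] : (1 : K) = 0 /\ - c = 0.
        by apply: (cross_free n0); rewrite scale1r scaleNr -e subrr.
      by rewrite oner_eq0.
    apply: uniq4; apply: ne;
      rewrite ?cross_vec vec_eq0 ?(mulr0, mul0r, mulr1, mul1r, subr0, sub0r)
        ?oppr_eq0 oner_eq0 ?andbF //.
  apply/existsP; exists [set P in [seq pt M v | v <- s]]; apply/and3P; split.
  + apply/subsetP => P; rewrite inE => /mapP[v vs ->]; apply/rational_pointsP.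
    exists v; rewrite s0 //; split=> //; move: vs.
    by rewrite !inE => /or4P[] /eqP ->; rewrite rational_vec ?subf0 ?subf1.
  + by apply/eqP; apply: etrans (card_set_seq us) _; rewrite size_map.
  apply/forall_inP => l /rational_linesP[w [w0 _ ->]].
  apply: leq_trans (card_sift_seq _ _) _; rewrite count_map.
  rewrite (eq_in_count (_ : {in s, _ =1 (fun v => dot v w == 0)})); last first.
    by move=> v /s0 v0; apply: on_pt_ln.
  rewrite [count _ _]/=.
  move: w0; have [x [y [z ->]]] := vecP w.
  rewrite vec_eq0 !dot_vec !mul0r !mul1r !addr0 !add0r addn0.
  (* The four points lie on the line according to the vanishing of x, y, z and x + y + z; three
     zeros among these would force w = 0. *)
  have [->|x0] := eqVneq x 0; have [->|y0] := eqVneq y 0; have [->|z0] := eqVneq z 0;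
    rewrite ?addr0 ?add0r ?eqxx ?(negbTE x0) ?(negbTE y0) ?(negbTE z0) //=;
    by case: (_ == _).
- by apply/forall_inP => l lL; rewrite card_rational_line.
Qed.

End RationalSubplane.

(** * Frames adapted to T and linf *)

Lemma frame_exists (T : point K) (l : line K) : on_line T l ->
  exists2 M, M \in unitmx & T = pt M (vec 1 0 0) /\ l = ln M (vec 0 0 1).
Proof.
move=> Tl; have dT := eqP (valP T); have dl := eqP (valP l).
have e00 : vpick (val T) != 0 by rewrite vpick0 -dimv_eq0 dT.
have TE : val T = <[vpick (val T)]>%VS.
  by apply/eqP; rewrite eq_sym eqEdim -memvE memv_pick dT dim_vline e00.
set e0 := vpick (val T) in e00 TE.
have /subvPn[e1 e1l e1T] : ~~ (val l <= <[e0]>)%VS.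
  by apply/negP => /dimvS; rewrite dl dim_vline e00.
have /subvPn[e2 _ e2l] : ~~ (fullv <= val l)%VS.
  by apply/negP => /dimvS; rewrite dl dimvf.
have e0l : e0 \in val l by move: Tl; rewrite /on_line TE -memvE.
(* The rows are a vector spanning T, one completing it to a basis of the line, and one off the
   line. *)
pose M := \matrix_(i < 3) [:: e0; e1; e2]`_i.
have ME x y z : vec x y z *m M = x *: e0 + y *: e1 + z *: e2.
  by rewrite mulmx_sum_row !big_ord_recl big_ord0 addr0 !rowK !mxE addrA.
have hM : M \in unitmx.
  rewrite -row_free_unit; apply: inj_row_free => v.
  have [x [y [z ->]]] := vecP v; rewrite ME => e.
  have z0 : z = 0.
    apply/eqP; apply: contraR e2l => z0; rewrite -[e2](scalerK z0) memvZ //.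
    by move/eqP: e; rewrite addrC addr_eq0 => /eqP ->; rewrite memvN memvD ?memvZ.
  have y0 : y = 0.
    apply/eqP; apply: contraR e1T => y0; rewrite -[e1](scalerK y0) memvZ //.
    move/eqP: e; rewrite z0 scale0r addr0 addrC addr_eq0 => /eqP ->.
    by rewrite memvN memvZ ?memv_line.
  move/eqP: e; rewrite z0 y0 !scale0r !addr0 scaler_eq0 (negbTE e00) orbF => /eqP ->.
  by apply/eqP; rewrite vec_eq0 eqxx.
have E0 : vec 1 0 0 *m M = e0 by rewrite ME scale1r !scale0r !addr0.
have E1 : vec 0 1 0 *m M = e1 by rewrite ME scale1r !scale0r addr0 add0r.
exists M => //; split; apply: val_inj.
  by rewrite val_pt ?vec_eq0 ?oner_eq0 // E0.
rewrite val_ln ?vec_eq0 ?oner_eq0 ?andbF //.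
have d : vec 0 0 1 != 0 :> 'rV[K]_3 by rewrite vec_eq0 oner_eq0 !andbF.
apply: (line_unique dl (eqP (dim_perp hM d)) e00 e1T e0l e1l).
  by rewrite -E0 mem_perp // dot_vec !mulr0 !mul0r !addr0.
by rewrite -E1 mem_perp // dot_vec !mulr0 !mul0r !addr0.
Qed.

Section Frame.

Variable M : 'M[K]_3.
Hypothesis hM : M \in unitmx.

Local Notation T := (pt M (vec 1 0 0)).
Local Notation linf := (ln M (vec 0 0 1)).

(** With T = <(1, 0, 0)> and linf given by z = 0, points and lines fall into affine families: [ipt]
    on linf away from T, [apt] off linf, [lnT] the lines Y = y Z through T other than linf, [aln]
    the lines X = u Y + v Z off T. *)
Definition ipt (u : K) : point K := pt M (vec u 1 0).
Definition apt (x y : K) : point K := pt M (vec x y 1).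
Definition lnT (y : K) : line K := ln M (vec 0 1 (- y)).
Definition aln (u v : K) : line K := ln M (vec 1 (- u) (- v)).

Local Ltac incidence := rewrite on_pt_ln ?vec_eq0 ?oner_eq0 ?andbF // dot_vec
  ?mulr0 ?mul0r ?mulr1 ?mul1r ?addr0 ?add0r ?oner_eq0 //.

Lemma T_linf : on_line T linf. Proof. by incidence. Qed.
Lemma T_lnT y : on_line T (lnT y). Proof. by incidence. Qed.
Lemma T_aln u v : on_line T (aln u v) = false. Proof. by incidence. Qed.
Lemma ipt_linf u : on_line (ipt u) linf. Proof. by incidence. Qed.
Lemma ipt_lnT u y : on_line (ipt u) (lnT y) = false. Proof. by incidence. Qed.
Lemma ipt_aln u u' v : on_line (ipt u) (aln u' v) = (u == u').
Proof. by incidence; rewrite subr_eq0. Qed.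
Lemma apt_linf x y : on_line (apt x y) linf = false. Proof. by incidence. Qed.
Lemma apt_lnT x y y' : on_line (apt x y) (lnT y') = (y == y').
Proof. by incidence; rewrite subr_eq0. Qed.
Lemma apt_aln x y u v : on_line (apt x y) (aln u v) = (x == u * y + v).
Proof. by incidence; rewrite mulrN mulrC -addrA -opprD subr_eq0. Qed.

Lemma ipt_inj : injective ipt.
Proof. by move=> u u' e; apply/eqP; rewrite -(ipt_aln u u' 0) e ipt_aln. Qed.

Lemma aln_inj u v u' v' : aln u v = aln u' v' -> u = u' /\ v = v'.
Proof.
move=> e; split; apply/eqP; first by rewrite -(ipt_aln u u' v') -e ipt_aln.
by rewrite -[v'](add0r) -(mulr0 u') -apt_aln -e apt_aln mulr0 add0r.
Qed.

Lemma apt_inj x y x' y' : apt x y = apt x' y' -> x = x' /\ y = y'.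
Proof.
move=> e; split; apply/eqP; last by rewrite eq_sym -(apt_lnT x') -e apt_lnT.
by rewrite eq_sym -[x](add0r) -(mul0r y') -apt_aln -e apt_aln mul0r add0r.
Qed.

Lemma T_neq_ipt u : T != ipt u.
Proof. by apply/eqP => e; have := ipt_lnT u 0; rewrite -e T_lnT. Qed.

Lemma T_neq_apt x y : T != apt x y.
Proof. by apply/eqP => e; have := apt_linf x y; rewrite -e T_linf. Qed.

Lemma point_cases P :
  [\/ P = T, exists u, P = ipt u | exists x y, P = apt x y].
Proof.
have [v + ->] := pt_surj hM P; have [x [y [z ->]]] := vecP v.
have [->|z0] := eqVneq z 0; last first.
  move=> v0; constructor 3; exists (x / z), (y / z); rewrite /apt.
  rewrite -(pt_scale hM (invr_neq0 z0) v0) scale_vec mulVf //.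
  by rewrite ![z^-1 * _]mulrC.
have [->|y0] := eqVneq y 0; last first.
  move=> v0; constructor 2; exists (x / y); rewrite /ipt.
  by rewrite -(pt_scale hM (invr_neq0 y0) v0) scale_vec mulVf // mulr0 mulrC.
move=> v0; constructor 1.
have x0 : x != 0 by move: v0; rewrite vec_eq0 eqxx !andbT.
by rewrite -(pt_scale hM (invr_neq0 x0) v0) scale_vec mulVf // !mulr0.
Qed.

Lemma line_cases l :
  [\/ l = linf, exists y, l = lnT y | exists u v, l = aln u v].
Proof.
have [w + ->] := ln_surj hM l; have [x [y [z ->]]] := vecP w.
have [->|x0] := eqVneq x 0; last first.
  move=> w0; constructor 3; exists (- (y / x)), (- (z / x)); rewrite /aln !opprK.
  by rewrite -(ln_scale hM (invr_neq0 x0) w0) scale_vec mulVf // ![x^-1 * _]mulrC.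
have [->|y0] := eqVneq y 0; last first.
  move=> w0; constructor 2; exists (- (z / y)); rewrite /lnT !opprK.
  by rewrite -(ln_scale hM (invr_neq0 y0) w0) scale_vec mulVf // mulr0 mulrC.
move=> w0; constructor 1.
have z0 : z != 0 by move: w0; rewrite vec_eq0 eqxx.
by rewrite -(ln_scale hM (invr_neq0 z0) w0) scale_vec mulVf // !mulr0.
Qed.

Definition affset (U : {set K}) : {set point K} := T |: ipt @: U.

Lemma T_affset U : T \in affset U. Proof. exact: setU11. Qed.

Lemma mem_affset U u : (ipt u \in affset U) = (u \in U).
Proof. by rewrite in_setU1 eq_sym (negbTE (T_neq_ipt u)) mem_imset //; apply: ipt_inj. Qed.

Lemma affsetS U V : (affset U \subset affset V) = (U \subset V).
Proof.
apply/idP/idP => /subsetP s; apply/subsetP.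
  by move=> u uU; rewrite -mem_affset s ?mem_affset.
by move=> _ /setU1P[->|/imsetP[u uU ->]]; rewrite ?T_affset // mem_affset s.
Qed.

Lemma affset_inj : injective affset.
Proof. by move=> U V e; apply/setP => u; rewrite -!mem_affset e. Qed.

Lemma affset_eq (S : {set point K}) (U : {set K}) :
  T \in S -> {in S, forall P, on_line P linf} ->
  (forall u, (ipt u \in S) = (u \in U)) -> S = affset U.
Proof.
move=> TS Sl SU; apply/setP => P.
have [->|[u ->]|[x [y ->]]] := point_cases P; first by rewrite TS T_affset.
  by rewrite mem_affset SU.
rewrite [RHS](_ : _ = false); first by apply/negP => /Sl; rewrite apt_linf.
apply/negP => /setU1P[/eqP|/imsetP[u _ e]].
  by rewrite eq_sym (negbTE (T_neq_apt x y)).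
by have := apt_linf x y; rewrite e ipt_linf.
Qed.

(** * Tangent splashes with centre T are the affine F-planes *)

Lemma subplane_elim (B : {set point K}) (L : {set line K}) : subplane q B L ->
  [/\ {in B &, forall P Q, P != Q ->
         exists2 l, l \in L & on_line P l /\ on_line Q l},
      {in L &, forall l m, l != m ->
         exists2 P, P \in B & on_line P l /\ on_line P m},
      exists X : {set point K}, [/\ X \subset B, #|X| = 4%N &
         {in L, forall l, #|[set P in X | on_line P l]| <= 2}%N]
    & {in L, forall l, #|[set P in B | on_line P l]| = q.+1}].
Proof.
case/and4P => /forall_inP h1 /forall_inP h2.
case/existsP => X /and3P[XB /eqP X4 /forall_inP X2] /forall_inP h4.
split.
- move=> P Q hP hQ PQ; have /cards1P[l e] := implyP (forall_inP (h1 P hP) Q hQ) PQ.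
  have : l \in [set l] by rewrite inE.
  by rewrite -e inE => /and3P[lL a b]; exists l.
- move=> l m hl hm lm; have /cards1P[P e] := implyP (forall_inP (h2 l hl) m hm) lm.
  have : P \in [set P] by rewrite inE.
  by rewrite -e inE => /and3P[PB a b]; exists P.
- by exists X; split.
- by move=> l /h4/eqP.
Qed.

Lemma tangent_splash_affine S : tangent_splash q linf T S ->
  exists b a1 a2, indep a1 a2 /\ S = affset (affine_plane b a1 a2).
Proof.
case/existsP => B /existsP[L /and3P[/subplane_elim + /eqP BT /eqP SE]].
case=> joinB meetL [X [XB X4 X2]] cL.
have TB : T \in B by have := set11 T; rewrite -BT inE => /andP[].
(* A line of the subplane carries q + 1 > 1 of its points, whereas linf carries only T. *)
have linfL : linf \notin L.
  apply/negP => /cL; rewrite BT cards1 => -[/esym q0].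
  by have := prime_power_gt1; rewrite q0.
have Baff P : P \in B -> P != T -> exists x y, P = apt x y.
  move=> PB; have [->|[u uE]|//] := point_cases P; first by rewrite eqxx.
  have : P \in [set P in B | on_line P linf] by rewrite inE PB uE ipt_linf.
  by rewrite BT inE => ->.
have LT l : l \in L -> on_line T l -> exists y, l = lnT y.
  have [->|//|[u [v ->]]] := line_cases l; first by rewrite (negbTE linfL).
  by rewrite T_aln.
pose A0 := [set a : K * K | aln a.1 a.2 \in L].
pose B0 := [set p : K * K | apt p.1 p.2 \in B].
have A0E u v : ((u, v) \in A0) = (aln u v \in L) by rewrite inE.
have B0E x y : ((x, y) \in B0) = (apt x y \in B) by rewrite inE.
have lnTL x y : apt x y \in B -> lnT y \in L.
  move=> pB; have [l lL [Tl pl]] := joinB _ _ TB pB (T_neq_apt x y).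
  have [y' e] := LT l lL Tl.
  by move: pl lL; rewrite e apt_lnT => /eqP ->.
(* A line of the subplane through T has a further point of [B], so the nonempty fibres correspond to
   these lines. *)
have YE y : (y \in [set y | [set x | (x, y) \in B0] != set0]) = (lnT y \in L).
  rewrite inE; apply/set0Pn/idP => [[x]|yL]; first by rewrite inE B0E; apply: lnTL.
  have /card_gt1P[P [Q [+ + PQ]]] : (1 < #|[set P in B | on_line P (lnT y)]|)%N.
    by rewrite cL //; apply: leqW prime_power_gt1.
  wlog PT : P Q PQ / P != T.
    move=> W hP hQ; have [PT|PT] := eqVneq P T; last exact: (W P Q).
    by apply: (W Q P); rewrite // eq_sym // -PT.
  rewrite !inE => /andP[PB +] _; have [x [y' e]] := Baff P PB PT.
  by rewrite e apt_lnT => /eqP e'; exists x; rewrite inE B0E -e' -e.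
have joinA x y x' y' : (x, y) \in B0 -> (x', y') \in B0 -> y != y' ->
    exists u v, [/\ (u, v) \in A0, x = u * y + v & x' = u * y' + v].
  rewrite !B0E => hp hp' yy.
  have pp : apt x y != apt x' y' by apply: contra yy => /eqP/apt_inj[_ ->].
  have [l lL []] := joinB _ _ hp hp' pp.
  have [lE|[y1 lE]|[u [v lE]]] := line_cases l; rewrite lE in lL *.
  - by rewrite apt_linf.
  - by rewrite !apt_lnT => /eqP e /eqP e'; rewrite e e' eqxx in yy.
  - by rewrite !apt_aln => /eqP e /eqP e'; exists u, v; rewrite A0E.
have [x0 [y0 p0B]] : exists x y, (x, y) \in B0.
  have : (0 < #|X :\ T|)%N.
    by rewrite -ltnS (leq_trans _ (leq_add (leq_b1 (T \in X)) (leqnn _))) // -cardsD1 X4.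
  case/card_gt0P => P /setD1P[PT PX]; have [x [y PE]] := Baff P (subsetP XB P PX) PT.
  by exists x, y; rewrite B0E -PE (subsetP XB).
have y0L : lnT y0 \in L by apply: (lnTL x0); rewrite -B0E.
(* At most two points of the quadrangle lie on the line joining T to the first point, so another
   one, distinct from T, is off it; joining it to the first point gives a line off T. *)
have [u0 [v0 uvA0]] : exists u v, (u, v) \in A0.
  have [|/subsetPn[Q /setD1P[QT QX]]] :=
    boolP (X :\ T \subset [set P in X | on_line P (lnT y0)]).
    move/subset_leq_card/leq_trans/(_ (X2 _ y0L)).
    have := cardsD1 T X; rewrite X4.
    by case: (T \in X); rewrite ?add0n ?add1n; [case=> <- | move=> <-].
  have [x' [y' QE]] := Baff Q (subsetP XB Q QX) QT.
  rewrite inE QX QE apt_lnT eq_sym => yy.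
  have qB : (x', y') \in B0 by rewrite B0E -QE (subsetP XB).
  by have [u [v [uvA _ _]]] := joinA _ _ _ _ p0B qB yy; exists u, v.
have meetA u v y : (u, v) \in A0 -> y \in [set y | [set x | (x, y) \in B0] != set0] ->
    (u * y + v, y) \in B0.
  rewrite YE A0E => aL yL.
  have ne : aln u v != lnT y by apply/eqP => e; have := T_aln u v; rewrite e T_lnT.
  have [P PB [Pa Py]] := meetL _ _ aL yL ne.
  have PT : P != T by apply/eqP => e; rewrite e T_aln in Pa.
  have [x [y' e]] := Baff P PB PT.
  by move: Pa Py PB; rewrite e apt_aln apt_lnT B0E => /eqP -> /eqP ->.
have [|||||b [a1 [a2 [ind e]]]] := @affine_structure A0 B0.
- move=> u v v'; rewrite !A0E => a a'; apply/eqP/contraT => vv.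
  have ne : aln u v != aln u v' by apply: contra vv => /eqP/aln_inj[_ ->].
  have [P PB [Pa Pa']] := meetL _ _ a a' ne.
  have PT : P != T by apply/eqP => e; rewrite e T_aln in Pa.
  have [x [y' e]] := Baff P PB PT.
  move: Pa Pa'; rewrite e !apt_aln => /eqP -> /eqP /addrI /eqP.
  by rewrite (negbTE vv).
- exact: meetA.
- exact: joinA.
(* Of the q + 1 points on a line through T, the point T itself is outside the fibre, which leaves
   q. *)
- move=> y; rewrite YE => yL; apply: succn_inj; rewrite -(cL _ yL).
  rewrite (cardsD1 T) inE TB T_lnT add1n; congr _.+1.
  rewrite -(card_imset _ (_ : injective (apt^~ y))); last by move=> x x' /apt_inj[].
  apply: eq_card => P; apply/imsetP/idP => [[x]|].
    by rewrite inE B0E => pB ->; rewrite !inE eq_sym T_neq_apt pB apt_lnT eqxx.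
  rewrite !inE => /and3P[PT PB]; have [x [y' e]] := Baff P PB PT.
  by rewrite e apt_lnT => /eqP <-; exists x; rewrite ?inE ?B0E -?e.
(* The q + 1 points of one line off T correspond to the lines of the subplane through T, one point
   on each. *)
- have aL : aln u0 v0 \in L by rewrite -A0E.
  rewrite -(cL _ aL).
  rewrite -(card_imset _ (_ : injective (fun y => apt (u0 * y + v0) y))); last first.
    by move=> y y' /apt_inj[].
  apply: eq_card => P; apply/imsetP/idP => [[y yY ->]|].
    by rewrite inE -B0E meetA // apt_aln eqxx.
  rewrite !inE => /andP[PB Pa].
  have PT : P != T by apply/eqP => e; rewrite e T_aln in Pa.
  have [x [y e]] := Baff P PB PT.
  move: Pa; rewrite e apt_aln => /eqP xE; exists y; last by rewrite -xE.
  by rewrite YE; apply: (lnTL x); rewrite -e.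
exists b, a1, a2; split=> //; rewrite -e SE; apply: affset_eq.
- by rewrite inE T_linf; apply/exists_inP; exists (lnT y0); rewrite // T_lnT.
- by move=> P; rewrite inE => /andP[].
(* Lines of the subplane through T meet linf only in T; the other points of the splash come from
   lines off T, each giving its slope. *)
move=> u; rewrite !inE ipt_linf /=; apply/exists_inP/existsP => [[l lL]|[v]].
  have [lE|[y lE]|[u' [v lE]]] := line_cases l; rewrite lE in lL *.
  - by rewrite (negbTE linfL) in lL.
  - by rewrite ipt_lnT.
  - by rewrite ipt_aln => /eqP ->; exists v; rewrite A0E.
by rewrite A0E => aL; exists (aln u v); rewrite // ipt_aln.
Qed.

Lemma pt_mull (N : 'M[K]_3) v : pt (N *m M) v = pt M (v *m N).
Proof. by rewrite /pt mulmxA. Qed.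

(** When point coordinates change by [N], line coordinates change by its inverse transpose [G],
    because [dot (v *m N) (w *m G) = dot v w]. *)
Lemma ln_mull (N G : 'M[K]_3) w :
  N \in unitmx -> G *m N^T = 1%:M -> w != 0 -> w *m G != 0 ->
  ln (N *m M) w = ln M (w *m G).
Proof.
move=> hN GN w0 wG0; have hNM : N *m M \in unitmx by rewrite unitmx_mul hN.
apply: val_inj; rewrite !val_ln //; apply/vspaceP => x.
rewrite -(mulmxKV hNM x); move: (x *m invmx _) => v.
by rewrite (mem_perp w v hNM) [v *m _]mulmxA mem_perp // dot_mull -mulmxA GN mulmx1.
Qed.

Lemma tangent_splash_of_affine b a1 a2 : indep a1 a2 ->
  tangent_splash q linf T (affset (affine_plane b a1 a2)).
Proof.
move=> ind; have a10 := indep_neq0 ind.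
(* The subplane whose lines have the coordinates w G with w rational: those off T
   are x = u y + v z with u = b + l a1 + m a2 and v = m. *)
pose G := \matrix_(i < 3) [:: vec 1 (- b) 0; vec 0 (- a1) 0; vec 0 (- a2) (-1)]`_i.
have GE n l m : vec n l m *m G = vec n (- (n * b + l * a1 + m * a2)) (- m).
  rewrite mulmx_sum_row !big_ord_recl big_ord0 addr0 !rowK !mxE /= !scale_vec !add_vec.
  by congr vec; ring.
have hG : G \in unitmx.
  rewrite -row_free_unit; apply: inj_row_free => v.
  have [n [l [m ->]]] := vecP v; rewrite GE => /eqP.
  rewrite vec_eq0 !oppr_eq0 => /and3P[/eqP -> /[swap] /eqP ->].
  rewrite !mul0r add0r addr0 mulf_eq0 (negbTE a10) orbF => /eqP ->.
  by apply/eqP; rewrite vec_eq0 eqxx.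
have GTE x y z : vec x y z *m G^T = vec (x - b * y) (- a1 * y) (- a2 * y - z).
  apply/rowP => i; rewrite !mxE !big_ord_recl big_ord0 !mxE.
  by case: i => -[|[|[|//]]] hi /=; rewrite !mxE /=; ring.
pose N := (invmx G)^T.
have hN : N \in unitmx by rewrite unitmx_tr unitmx_inv.
have hNM : N *m M \in unitmx by rewrite unitmx_mul hN.
have GN : G *m N^T = 1%:M by rewrite trmxK mulmxV.
have NG : N *m G^T = 1%:M by rewrite -trmx_mul mulmxV // trmx1.
have lnE w : w != 0 -> ln (N *m M) w = ln M (w *m G).
  by move=> w0; apply: ln_mull => //; rewrite (mulM_eq0 hG).
have T0 : vec 1 0 0 != 0 by rewrite vec_eq0 oner_eq0.
(* T has the same coordinates in both frames, hence is a rational point of the new one. *)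
have TN : vec 1 0 0 *m N = vec 1 0 0.
  have {1}-> : vec 1 0 0 = vec 1 0 0 *m G^T by rewrite GTE !mulr0 !subr0.
  by rewrite -mulmxA -[G^T *m N]trmxK trmx_mul trmxK trmxK mulVmx // trmx1 mulmx1.
apply/existsP; exists (rational_points (N *m M)).
apply/existsP; exists (rational_lines (N *m M)); apply/and3P; split.
- exact: rational_subplane.
- apply/eqP/setP => P; rewrite in_set in_set1; apply/andP/eqP => [[]|->]; last first.
    rewrite T_linf; split=> //; apply/rational_pointsP; exists (vec 1 0 0).
    by rewrite T0 rational_vec subf0 subf1 pt_mull TN.
  have [//|[u ->] + _|[x [y ->]]] := point_cases P; last by rewrite apt_linf.
  case/rational_pointsP => v [v0 rv]; rewrite pt_mull => /esym/eqP.
  have u0 : vec u 1 0 != 0 by rewrite vec_eq0 oner_eq0 andbF.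
  have vN0 : v *m N != 0 by rewrite (mulM_eq0 hN).
  case/(eq_pt hM u0 vN0) => c e.
  have vE : v = vec (c * (u - b)) (- (c * a1)) (- (c * a2)).
    rewrite -[v]mulmx1 -NG mulmxA e -scalemxAl GTE scale_vec.
    by congr vec; ring.
  have [ca1 ca2] : c * a1 \in F /\ c * a2 \in F.
    by move: rv; rewrite vE rational_vec => /and3P[_ /subfN + /subfN]; rewrite !opprK.
  (* The trivial relation (c a2) a1 - (c a1) a2 = 0 has coefficients in F, so independence forces c
     = 0: no rational point other than T is on linf. *)
  have [_ /eqP] : c * a2 = 0 /\ - (c * a1) = 0.
    by apply: ind => //; [exact: subfN | ring].
  rewrite oppr_eq0 mulf_eq0 (negbTE a10) orbF => c0; case/eqP: v0.
  by rewrite vE (eqP c0) !mul0r oppr0; apply/eqP; rewrite vec_eq0 eqxx.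
apply/eqP/esym/affset_eq.
- rewrite in_set T_linf; apply/exists_inP; exists (ln (N *m M) (vec 0 1 0)).
    apply/rational_linesP; exists (vec 0 1 0).
    by rewrite vec_eq0 oner_eq0 andbF rational_vec subf0 subf1.
  rewrite lnE ?vec_eq0 ?oner_eq0 ?andbF // GE on_pt_ln //.
    by rewrite dot_vec !mul0r mulr0 !addr0.
  by rewrite vec_eq0 !oppr_eq0 mul1r !mul0r add0r addr0 (negbTE a10) andbF.
- by move=> P; rewrite in_set => /andP[].
move=> u; rewrite in_set ipt_linf /=; apply/exists_inP/affine_planeP.
  case=> _ /rational_linesP[w [w0 + ->]]; rewrite (lnE _ w0).
  move: w0; rewrite -(mulM_eq0 hG); have [n [l [m ->]]] := vecP w.
  rewrite GE rational_vec => w0 /and3P[nF lF mF].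
  rewrite on_pt_ln // ?dot_vec ?vec_eq0 ?oner_eq0 ?andbF // mul1r mul0r addr0.
  rewrite subr_eq0 => /eqP e.
  (* If n = 0, incidence reads l a1 + m a2 = 0, so w would vanish. Dividing by n then normalises the
     line to the form 1, l, m. *)
  have n0 : n != 0.
    apply: contraNneq w0 => n0; have [l0 m0] : l = 0 /\ m = 0.
      by apply: ind => //; move: e; rewrite n0 mulr0 mul0r add0r => <-.
    by rewrite n0 l0 m0 !mul0r !addr0 oppr0 vec_eq0 eqxx.
  exists (l / n), (m / n); rewrite !subfM ?subfV //; split=> //.
  by apply: (mulIf n0); rewrite e; field.
case=> l [m [lF mF ->]].
have w0 : vec 1 l m != 0 by rewrite vec_eq0 oner_eq0.
exists (ln (N *m M) (vec 1 l m)).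
  by apply/rational_linesP; exists (vec 1 l m); rewrite rational_vec subf1 lF mF.
rewrite lnE // GE on_pt_ln ?vec_eq0 ?oner_eq0 ?andbF // dot_vec.
by apply/eqP; ring.
Qed.

(** * Sublines of linf through T are the affine F-lines *)

Definition vec2 (x y : K) : 'rV[K]_2 := \row_(i < 2) [:: x; y]`_i.

Lemma vec2P (v : 'rV[K]_2) : exists x y, v = vec2 x y.
Proof.
exists (v 0 0), (v 0 1); apply/rowP => i; rewrite mxE.
by case: i => -[|[|//]] hi /=; congr (v 0 _); apply: val_inj.
Qed.

Lemma vec2_eq0 x y : (vec2 x y == 0) = (x == 0) && (y == 0).
Proof.
apply/eqP/andP => [/rowP e|[/eqP-> /eqP->]].
  by have := (e 0, e 1); rewrite !mxE /= => -[-> ->].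
by apply/rowP => i; rewrite !mxE; case: i => -[|[|//]].
Qed.

Definition subline_of (f : 'Hom('rV[K]_2, 'rV[K]_3)) : {set point K} :=
  [set P | [exists Q in canonical_subline K q, val P == (f @: val Q)%VS]].

Lemma subline_ofP (f : 'Hom('rV[K]_2, 'rV[K]_3)) (P : point K) : reflect
  (exists x y, [/\ x \in F, y \in F & val P = <[f (vec2 x y)]>%VS]) (P \in subline_of f).
Proof.
rewrite inE; apply: (iffP exists_inP) => [[Q]|[x [y [xF yF PE]]]].
  rewrite inE => /existsP[v /and3P[_ /forallP rv /eqP QE]] /eqP ->.
  exists (v 0 0), (v 0 1); rewrite !inE !rv QE limg_line; split=> //.
  congr <[f _]>%VS; apply/rowP => i; rewrite mxE.
  by case: i => -[|[|//]] hi /=; congr (v 0 _); apply: val_inj.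
have v0 : vec2 x y != 0.
  apply/eqP => e; have := eqP (valP P).
  by rewrite /= PE e linear0 dim_vline eqxx.
have dQ : \dim <[vec2 x y]>%VS == 1%N by rewrite dim_vline v0.
pose Q : flat K 2 1 := exist (fun U : {vspace _} => \dim U == 1%N) _ dQ.
exists Q; last by rewrite /= limg_line PE.
rewrite inE; apply/existsP; exists (vec2 x y); rewrite v0 eqxx andbT.
apply/forallP => i; rewrite mxE; move: xF yF; rewrite !inE.
by case: i => -[|[|//]].
Qed.

Lemma val_eq_pt (P : point K) (v : 'rV[K]_3) :
  val P = <[v *m M]>%VS -> v != 0 /\ P = pt M v.
Proof.
move=> e; have v0 : v != 0.
  by apply/eqP => v0; have := eqP (valP P); rewrite /= e v0 mul0mx dim_vline eqxx.
by split=> //; apply: val_inj; rewrite val_pt.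
Qed.

(* An F-rational point <(s, t)> that f maps to T is completed to a basis
   (s, t), (s', t') of F^2; the affine coordinates of the image are then
   those of the points (s', t') + l (s, t). *)
Lemma subline_affine m : subline q linf m -> T \in m ->
  exists b a, a != 0 /\ m = affset (affine_line b a).
Proof.
case=> f fl -> /subline_ofP[s [t [sF tF TE]]].
have d0 : vec 0 0 1 != 0 :> 'rV[K]_3 by rewrite vec_eq0 oner_eq0 !andbF.
have fE : exists p r p' r', forall x y,
    f (vec2 x y) = vec (x * p + y * p') (x * r + y * r') 0 *m M.
  have coord v : exists p r, f v = vec p r 0 *m M.
    have [p [r [z e]]] := vecP (f v *m invmx M).
    have fvE : f v = vec p r z *m M by rewrite -e mulmxKV.
    have : f v \in limg f by rewrite memv_img ?memvf.
    rewrite fl val_ln // fvE mem_perp // dot_vec !mulr0 !add0r mulr1 => /eqP z0.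
    by exists p, r; rewrite z0.
  have [p [r e]] := coord (vec2 1 0); have [p' [r' e']] := coord (vec2 0 1).
  exists p, r, p', r' => x y.
  have -> : vec2 x y = x *: vec2 1 0 + y *: vec2 0 1.
    by apply/rowP => i; rewrite !mxE; case: i => -[|[|//]] hi /=; ring.
  rewrite linearD !linearZ /= e e' !scalemxAl -mulmxDl !scale_vec add_vec.
  by rewrite !mulr0 addr0.
have [p [r [p' [r' {}fE]]]] := fE.
have [s' [t' [s'F t'F det1]]] : exists s' t', [/\ s' \in F, t' \in F & s * t' - t * s' = 1].
  have [s0|s0] := eqVneq s 0; last first.
    by exists 0, s^-1; rewrite subf0 subfV // mulr0 subr0 divff.
  have [t0|t0] := eqVneq t 0; last first.
    by exists (- t^-1), 0; rewrite subf0 subfN ?subfV // s0 mul0r mulrN opprK add0r divff.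
  have := eqP (valP T); rewrite /= TE fE s0 t0 !mul0r !addr0.
  by rewrite (_ : vec 0 0 0 = 0) ?mul0mx ?dim_vline ?eqxx //; apply/eqP; rewrite vec_eq0 eqxx.
(* Cramer's rule for the basis (s, t), (s', t') of determinant 1. *)
have basis x y : vec2 x y =
    vec2 ((x * t' - y * s') * s + (y * s - x * t) * s')
         ((x * t' - y * s') * t + (y * s - x * t) * t').
  by congr vec2; rewrite -[LHS]mulr1 -det1; ring.
have T0 : vec 1 0 0 != 0 by rewrite vec_eq0 oner_eq0.
move: TE; rewrite fE => /val_eq_pt[v0 /eqP/(eq_pt hM v0 T0)[c]].
rewrite scale_vec => /vec_inj[e1 e2 _].
have c0 : c != 0 by apply/eqP => c0; move/eqP: e1; rewrite c0 mul0r oner_eq0.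
have rst : s * r + t * r' = 0.
  by apply/eqP; move/esym/eqP: e2; rewrite mulf_eq0 (negbTE c0).
(* In the new basis (i, j) is sent to (i tau + j kap, j rho, 0), so for j nonzero the affine
   coordinate is kap / rho + (i / j) (tau / rho). *)
pose tau := s * p + t * p'; pose kap := s' * p + t' * p'; pose rho := s' * r + t' * r'.
have tau0 : tau != 0 by apply/eqP => h; move/eqP: e1; rewrite -/tau h mulr0 oner_eq0.
have fE' i j : f (vec2 (i * s + j * s') (i * t + j * t')) =
    vec (i * tau + j * kap) (j * rho) 0 *m M.
  rewrite fE; congr (vec _ _ _ *m M); first by rewrite /tau /kap; ring.
  by rewrite -[RHS]add0r -(mulr0 i) -rst /rho; ring.
(* If rho vanished, the image of f would be confined to T instead of filling linf. *)
have rho0 : rho != 0.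
  apply/eqP => rho0; have : vec 0 1 0 *m M \in limg f.
    by rewrite fl val_ln // mem_perp // dot_vec !mulr0 !mul0r !addr0.
  case/memv_imgP => v _; have [x [y ->]] := vec2P v.
  rewrite basis fE' rho0 mulr0 => e.
  have /vec_inj[_ /eqP] : vec 0 1 0 = vec ((x * t' - y * s') * tau + (y * s - x * t) * kap) 0 0.
    by rewrite -[LHS](mulmxK hM) e mulmxK.
  by rewrite oner_eq0.
exists (kap / rho), (tau / rho); split; first by rewrite mulf_neq0 ?invr_eq0.
apply: affset_eq.
- apply/subline_ofP; exists (1 * s + 0 * s'), (1 * t + 0 * t').
  rewrite fE' !mul1r !mul0r !addr0; split=> //.
  have -> : vec tau 0 0 = tau *: vec 1 0 0 by rewrite scale_vec mulr1 mulr0.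
  have tv0 : tau *: vec 1 0 0 != 0 by rewrite scaler_eq0 negb_or tau0.
  by rewrite -(val_pt hM tv0) pt_scale.
- move=> P /subline_ofP[x [y [_ _ e]]].
  by rewrite /on_line e -memvE -fl memv_img ?memvf.
move=> u; have u0 : vec u 1 0 != 0 by rewrite vec_eq0 oner_eq0 andbF.
apply/subline_ofP/affine_lineP => [[x [y [xF yF]]]|[l lF ->]].
  rewrite basis; set i := x * t' - y * s'; set j := y * s - x * t.
  have iF : i \in F by rewrite subfB ?subfM.
  have jF : j \in F by rewrite subfB ?subfM.
  rewrite fE' => /val_eq_pt[w0 /eqP/(eq_pt hM w0 u0)[d]].
  rewrite scale_vec => /vec_inj[uE dE _].
  have j0 : j != 0.
    by apply/eqP => j0; move/eqP: dE; rewrite j0 mul0r mulr0 oner_eq0.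
  exists (i / j); first by rewrite subfM ?subfV.
  have -> : u = d * (i * tau + j * kap) by [].
  have -> : d = (j * rho)^-1.
    by apply: (mulIf (mulf_neq0 j0 rho0)); rewrite mulVf ?mulf_neq0 // -dE.
  by field; rewrite j0 rho0.
exists (l * s + 1 * s'), (l * t + 1 * t'); split; [by rewrite subfD ?subfM ?subf1..|].
rewrite fE' !mul1r.
have -> : vec (l * tau + kap) rho 0 = rho *: vec (kap / rho + l * (tau / rho)) 1 0.
  by rewrite scale_vec; congr vec; field.
have w0 : vec (kap / rho + l * (tau / rho)) 1 0 != 0 by rewrite vec_eq0 oner_eq0 andbF.
have rw0 : rho *: vec (kap / rho + l * (tau / rho)) 1 0 != 0 by rewrite scaler_eq0 negb_or rho0.
by rewrite -(val_pt hM rw0) pt_scale.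
Qed.

(** The parametrisation sends (1, 0) to a (1, 0, 0), which spans T, and (0, 1) to (b, 1, 0); then
    (l, 1) goes to the point with affine coordinate b + l a. *)
Lemma subline_of_affine b a : a != 0 -> subline q linf (affset (affine_line b a)).
Proof.
move=> a0.
have d0 : vec 0 0 1 != 0 :> 'rV[K]_3 by rewrite vec_eq0 oner_eq0 !andbF.
pose N : 'M[K]_(2, 3) := \matrix_(i < 2) [:: vec a 0 0; vec b 1 0]`_i.
pose f : 'Hom('rV[K]_2, 'rV[K]_3) := linfun (mulmxr (N *m M)).
have fE x y : f (vec2 x y) = vec (x * a + y * b) y 0 *m M.
  rewrite lfunE /= mulmxA; congr (_ *m M).
  rewrite mulmx_sum_row !big_ord_recl big_ord0 addr0 !rowK !mxE /= !scale_vec add_vec.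
  by congr vec; ring.
exists f.
  apply/eqP; rewrite eqEdim; apply/andP; split.
    apply/subvP => _ /memv_imgP[v _ ->]; have [x [y ->]] := vec2P v.
    by rewrite fE val_ln // mem_perp // dot_vec !mulr0 mul0r !addr0.
  rewrite (eqP (valP linf)) limg_dim_eq ?dimvf //; apply/eqP; rewrite -subv0; apply/subvP => v.
  rewrite memv_cap memv_ker memvf /=; have [x [y ->]] := vec2P v.
  rewrite fE mulM_eq0 // vec_eq0 eqxx andbT => /andP[+ /eqP y0].
  by rewrite y0 mul0r addr0 mulf_eq0 (negbTE a0) orbF => /eqP ->; rewrite memv0 vec2_eq0 eqxx.
apply/esym/affset_eq.
- apply/subline_ofP; exists 1, 0; rewrite subf1 subf0 fE mul1r mul0r addr0; split=> //.
  have -> : vec a 0 0 = a *: vec 1 0 0 by rewrite scale_vec mulr1 mulr0.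
  have T0 : vec 1 0 0 != 0 by rewrite vec_eq0 oner_eq0.
  have aT0 : a *: vec 1 0 0 != 0 by rewrite scaler_eq0 negb_or a0.
  by rewrite -(val_pt hM aT0) pt_scale.
- move=> P /subline_ofP[x [y [_ _ e]]].
  by rewrite /on_line e fE val_ln // -memvE mem_perp // dot_vec !mulr0 mul0r !addr0.
move=> u; have u0 : vec u 1 0 != 0 by rewrite vec_eq0 oner_eq0 andbF.
apply/subline_ofP/affine_lineP => [[x [y [xF yF]]]|[l lF ->]].
  rewrite fE => /val_eq_pt[w0 /eqP/(eq_pt hM w0 u0)[d]].
  rewrite scale_vec => /vec_inj[uE dE _].
  have y0 : y != 0 by apply/eqP => y0; move/eqP: dE; rewrite y0 mulr0 oner_eq0.
  exists (x / y); first by rewrite subfM ?subfV.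
  rewrite uE; have -> : d = y^-1 by apply: (mulIf y0); rewrite mulVf.
  by field.
have w0 : vec (b + l * a) 1 0 != 0 by rewrite vec_eq0 oner_eq0 andbF.
by exists l, 1; rewrite subf1 lF fE mul1r [l * a + b]addrC -(val_pt hM w0).
Qed.

End Frame.

End Splash.

Theorem theorem5p4 (q : nat) (K : finFieldType) (hq : prime_power q)
    (hK : #|K| = (q ^ 3)%N) (linf : line K) (T : point K)
    (hT : on_line T linf) :
  (forall S1 S2 : {set point K},
     tangent_splash q linf T S1 -> tangent_splash q linf T S2 -> S1 <> S2 ->
     exists m : {set point K},
       [/\ subline q linf m, T \in m & S1 :&: S2 \subset m]) /\
  (forall m : {set point K}, subline q linf m -> T \in m ->
     #|[set S : {set point K} | tangent_splash q linf T S & m \subset S]|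
       = q.+1).
Proof.
have [M hM [-> ->]] := frame_exists hT; split.
  move=> S1 S2 /(tangent_splash_affine hq hK hM)[b [a1 [a2 [ind ->]]]].
  move=> /(tangent_splash_affine hq hK hM)[b' [a1' [a2' [ind' ->]]]] ne.
  have /(affine_plane_meet hq hK ind ind')[p [c [c0 sub]]] :
      affine_plane q b a1 a2 != affine_plane q b' a1' a2'.
    by apply/eqP => e; apply: ne; rewrite e.
  exists (affset M (affine_line q p c)); split.
  - exact: subline_of_affine.
  - exact: T_affset.
  apply/subsetP => P; rewrite in_setI => /andP[/setU1P[->|/imsetP[u uU ->]]].
    by move=> _; apply: T_affset.
  by rewrite !mem_affset // => uU'; apply: (subsetP sub); rewrite in_setI uU.
move=> m ml Tm; have [b [a [a0 ->]]] := subline_affine hq hK hM ml Tm.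
(* The injection [affset] turns the count of splashes containing m into that of the planes through
   the affine line of m. *)
rewrite -(card_planes_through_line hq hK b a0) -(card_imset _ (affset_inj hM)).
apply: eq_card => S; rewrite in_set; apply/andP/imsetP.
  case=> /(tangent_splash_affine hq hK hM)[b' [a1 [a2 [ind ->]]]].
  rewrite affsetS // => /(plane_through_line hq hK a0 ind)[c ca ->].
  by exists (affine_plane q b a c) => //; apply/imsetP; exists c; rewrite ?in_setC.
case=> _ /imsetP[c + ->] ->; rewrite in_setC => /(indep_notin_multiples hq hK a0) ind.
by rewrite affsetS // affine_line_sub_plane // tangent_splash_of_affine.
Qed.
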